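(* Let $E\subset\mathbb R^n$ be a $d$-Ahlfors regular set with $0<d<n-2$ (not necessarily an integer) and let $\mu$ be a $d$-Ahlfors regular measure with support $E$. If $\alpha=n-d-2$, then $D_{\mu,\alpha}$ (extended by $0$ on $E$) is the Green function with pole at infinity for $E$, associated to $\mu$ and $\alpha$.
   Context: Ahlfors regularity: a measure $\mu$ with support the closed set $E\subset\mathbb R^n$ is $d$-Ahlfors regular if there is $C\ge1$ with $C^{-1}r^d\le\mu(B(Q,r))\le Cr^d$ for all $Q\in E$ and $0<r<\mathrm{diam}(E)$; $E$ is $d$-Ahlfors regular if $\mathcal H^d|_E$ is. Standing assumption: $E$ is unbounded. Notation: $\Omega=\mathbb R^n\setminus E$, $\delta(x)=\mathrm{dist}(x,E)$. For $\beta>0$ and $x\in\Omega$, $D_{\mu,\beta}(x)=\big(\int_E|x-y|^{-d-\beta}\,d\mu(y)\big)^{-1/\beta}$, and $L_{\mu,\beta}u=-\mathrm{div}\big(D_{\mu,\beta}^{-(n-d-1)}\nabla u\big)$, understood weakly. Sobolev spaces: with $w(x)=\delta(x)^{-(n-d-1)}$, $W=\{u\in L^1_{\mathrm{loc}}(\mathbb R^n\setminus E):\nabla u\in L^2(\mathbb R^n\setminus E,w\,dx)\}$; for open $\mathcal O\subset\mathbb R^n$, $W_r(\mathcal O)=\{u\in L^1_{\mathrm{loc}}(\mathcal O):\varphi u\in W\text{ for all }\varphi\in C_0^\infty(\mathcal O)\}$. Pole at infinity: a function $u_\infty$ and a (positive, locally finite Borel) measure $\omega_\infty$ on $E$ are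 the Green function and harmonic measure with pole at infinity associated to $\mu,\beta$ if $u_\infty\in W_r(B(Q,R))\cap C(\mathbb R^n)$ for all $Q\in E$, $R>0$; $u_\infty>0$ in $\Omega$; $u_\infty=0$ on $E$; $L_{\mu,\beta}u_\infty=0$ in $\Omega$; and $\int_\Omega D_{\mu,\beta}^{-(n-d-1)}\nabla u_\infty\cdot\nabla\varphi\,dX=\int_E\varphi\,d\omega_\infty$ for all $\varphi\in C_0^\infty(\mathbb R^n)$. A function $u_\infty$ is called the Green function with pole at infinity if such an $\omega_\infty$ exists for it; it is unique up to multiplication by a positive scalar.
   Formalization: In the identity defining the harmonic measure with pole at infinity, the right-hand side is taken as minus the integral of φ against ω_∞; with the printed plus sign no positive measure ω_∞ can exist for D_{μ,α}. *)

(* Defs.v *)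
From HB Require Import structures.
From mathcomp Require Import all_boot all_order all_algebra.
From mathcomp Require Import all_classical all_reals all_analysis.
From mathcomp Require Import measurable_realfun.

Set Implicit Arguments.
Unset Strict Implicit.
Unset Printing Implicit Defensive.

Import Order.TTheory GRing.Theory Num.Theory.
Import numFieldNormedType.Exports.

Local Open Scope classical_set_scope.
Local Open Scope ring_scope.

HB.instance Definition _ (R : realType) (n : nat) :=
  @isMeasurable.Build (sigma_display (@open 'rV[R]_n)) 'rV[R]_n
    <<s @open 'rV[R]_n >>
    (@sigma_algebra0 _ setT (@open 'rV[R]_n))
    (@sigma_algebraC _ (@open 'rV[R]_n))
    (@sigma_algebra_bigcup _ setT (@open 'rV[R]_n)).

Section lebesgue_measure_rV.
Context {R : realType}.

Definition consrV m (p : measurableTypeR R * 'rV[R]_m) : 'rV[R]_m.+1 :=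
  row_mx p.1%:M p.2.

(* Lebesgue measure on the Borel sets of R^n, as an iterated product. *)
Fixpoint leb n : set 'rV[R]_n -> \bar R :=
  match n with
  | 0 => \d_ (0 : 'rV[R]_0)
  | m.+1 => pushforward (@lebesgue_measure R \x @leb m)%E (@consrV m)
  end.

Lemma open_measurable_rV n (U : set 'rV[R]_n) : open U -> measurable U.
Proof. exact: sub_sigma_algebra. Qed.

Lemma consrV_ball m (p q : R * 'rV[R]_m) (e : R) :
  ball (consrV p) e (consrV q) <-> ball p.1 e q.1 /\ ball p.2 e q.2.
Proof.
have E0 (x : R * 'rV[R]_m) i :
    consrV x ord0 (lshift m i : 'I_(1 + m)) = x.1.
  by rewrite /consrV (row_mxEl (n1 := 1)) mxE (ord1 i) eqxx.
have E1 (x : R * 'rV[R]_m) j :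
    consrV x ord0 (rshift 1 j : 'I_(1 + m)) = x.2 ord0 j.
  by rewrite /consrV (row_mxEr (n1 := 1)).
split=> [[e0 h]|[h1 [e0 h2]]].
  split; first by have := h ord0 (lshift m (ord0 : 'I_1)); rewrite !E0.
  split=> [|i j]; first exact: e0.
  by rewrite (ord1 i); have := h ord0 (rshift 1 j); rewrite !E1.
split=> // i j; rewrite (ord1 i).
rewrite -[j](@splitK 1 m); case: (fintype.split (j : 'I_(1 + m))) => k /=.
  by rewrite !E0.
by rewrite !E1.
Qed.

Lemma measurable_consrV m : measurable_fun setT (@consrV m).
Proof.
apply: (@measurability _ _ _ _ _ _ (@open 'rV[R]_m.+1)) => //.
move=> _ [U oU <-]; rewrite setTI.
pose B (t : rat * 'rV[rat]_m * rat) : set (measurableTypeR R * 'rV[R]_m) :=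
  ball (ratr t.1.1 : R) (ratr t.2 : R) `*`
  ball (map_mx ratr t.1.2 : 'rV[R]_m) (ratr t.2 : R).
have -> : @consrV m @^-1` U =
    \bigcup_(t in [set t | B t `<=` @consrV m @^-1` U]) B t.
  apply/seteqP; split=> [p Up|p [t tU /tU //]].
  have /nbhs_ballP[e /= e0 eU] : nbhs (consrV p) U by exact: open_nbhs_nbhs.
  have [r r0 re] : exists2 r : rat, (0 : R) < ratr r & ratr r < e / 2.
    have e20 : 0 < e / 2 by rewrite divr_gt0.
    have [r] := rat_in_itvoo e20.
    by rewrite in_itv /= => /andP[? ?]; exists r.
  have H (x : R) : exists q : rat, ball (ratr q : R) (ratr r) x.
    have xr : x - ratr r < x + ratr r.
      by rewrite ltrBlDr -addrA ltrDl addr_gt0.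
    have [q] := rat_in_itvoo xr.
    rewrite in_itv /= => /andP[q1 q2]; exists q.
    by rewrite /ball /= distrC ltr_distlC q1 q2.
  have [q pq] := H p.1.
  have [v pv] := choice (fun j => H (p.2 ord0 j)).
  exists (q, \row_j v j, r) => /=; last first.
    split=> //=; split=> // i j; rewrite (ord1 i) !mxE; exact: pv.
  move=> y [/= y1 [_ y2]]; apply: eU; apply/consrV_ball.
  have ee : ratr r + ratr r <= e :> R by rewrite (splitr e) ltW // ltrD.
  split; first exact: le_ball ee _ (ball_triangle (ball_sym pq) y1).
  split=> // i j; rewrite (ord1 i).
  apply: le_ball ee _ _; apply: ball_triangle (y2 ord0 j).
  by rewrite !mxE; apply: ball_sym.
rewrite bigcup_mkcond; apply: countable_bigcupT_measurable => //.
move=> t; case: ifPn => // _; apply: measurableX.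
  by apply: open_measurable; exact: ball_open.
by apply: open_measurable_rV; exact: ball_open.
Qed.

Lemma preimage_consrV_ball m (e : R) :
  @consrV m @^-1` ball (0 : 'rV[R]_m.+1) e =
  ball (0 : R) e `*` ball (0 : 'rV[R]_m) e.
Proof.
have c0 : consrV (0, 0) = 0 :> 'rV[R]_m.+1.
  by rewrite /consrV /= raddf0; exact: (@row_mx0 R 1 1 m).
apply/seteqP; split=> p; rewrite /preimage /= -c0.
  exact: (consrV_ball (0, 0) p e).1.
exact: (consrV_ball (0, 0) p e).2.
Qed.

Lemma sigma_finite_rV n (m : {measure set 'rV[R]_n -> \bar R}) :
  (forall e : R, 0 < e -> (m (ball (0%R : 'rV[R]_n) e) < +oo)%E) ->
  sigma_finite setT m.
Proof.
move=> mfin; exists (fun k => ball (0 : 'rV[R]_n) k.+1%:R).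
  apply/esym/seteqP; split=> // x _.
  exists (Num.truncn `|x|) => //.
  rewrite -ball_normE /ball_ /= sub0r normrN; exact: truncnS_gt.
move=> k; split; last exact: mfin.
by apply: open_measurable_rV; exact: ball_open.
Qed.

Section finite_on_balls.
Variables (n : nat) (m : {measure set 'rV[R]_n -> \bar R}).
Hypothesis mfin : forall e : R, 0 < e -> (m (ball (0%R : 'rV[R]_n) e) < +oo)%E.
(* Alias of [m] that can carry the sigma-finite structure. *)
Definition finite_on_balls (_ : forall e : R, 0 < e ->
  (m (ball (0%R : 'rV[R]_n) e) < +oo)%E) := (m : set _ -> \bar R).
HB.instance Definition _ := Measure.on (finite_on_balls mfin).
HB.instance Definition _ :=
  @Measure_isSigmaFinite.Build _ _ R (finite_on_balls mfin) (sigma_finite_rV mfin).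
End finite_on_balls.

Lemma leb_is_measure n : exists2 m : {measure set 'rV[R]_n -> \bar R},
  @leb n = m & forall e : R, 0 < e -> (m (ball (0%R : 'rV[R]_n) e) < +oo)%E.
Proof.
elim: n => [|n [m mE mfin]].
  exists (\d_ (0 : 'rV[R]_0)) => // e e0.
  by rewrite /= diracE ltry.
pose sm : {sigma_finite_measure set 'rV[R]_n -> \bar R} := finite_on_balls mfin.
pose pm : {measure set (measurableTypeR R * 'rV[R]_n)%type -> \bar R} :=
  (@lebesgue_measure R \x sm)%E.
exists (measure_function_pushforward__canonical__measure_function_Measure pm
  (measurable_consrV (m := n))).
  by rewrite /= mE.
move=> e e0 /=; rewrite /pushforward preimage_consrV_ball.
have mB : measurable (ball (0 : 'rV[R]_n) e).
  by apply: open_measurable_rV; exact: ball_open.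
rewrite product_measure1E//; last exact: measurable_ball.
apply: (@le_lt_trans _ _ ((e *+ 2)%:E * m (ball (0%R : 'rV[R]_n) e))%E).
  by rewrite -(lebesgue_measure_ball 0 (ltW e0)).
by rewrite lte_mul_pinfty ?lee_fin ?mulrn_wge0 ?ltW ?mfin.
Qed.

Let leb0 n : @leb n set0 = 0%E.
Proof. by have [m -> _] := leb_is_measure n. Qed.

Let leb_ge0 n A : (0 <= @leb n A)%E.
Proof. by have [m -> _] := leb_is_measure n. Qed.

Let leb_sigma_additive n : semi_sigma_additive (@leb n).
Proof.
by have [m -> _] := leb_is_measure n; exact: measure_semi_sigma_additive.
Qed.

HB.instance Definition _ n := isMeasure.Build _ _ _ (@leb n)
  (leb0 n) (@leb_ge0 n) (@leb_sigma_additive n).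

Let leb_sigma_finite n : sigma_finite setT (@leb n).
Proof. by have [m -> mfin] := leb_is_measure n; exact: sigma_finite_rV. Qed.

HB.instance Definition _ n :=
  @Measure_isSigmaFinite.Build _ _ _ (@leb n) (@leb_sigma_finite n).

End lebesgue_measure_rV.

Section euclidean.
Context {R : realType} {n : nat}.
Local Notation Rn := 'rV[R]_n.
Implicit Types (x y : Rn) (A E : set Rn).

Definition dotv x y : R := \sum_i x ord0 i * y ord0 i.

(* The library norm [`|x|] on row vectors is the maximum norm: it has the same
   topology and bounded sets, but distances must be measured with [enorm]. *)
Definition enorm x : R := Num.sqrt (dotv x x).

Definition eball x (r : R) : set Rn := [set y | enorm (y - x) < r].

Definition edist x E : R := inf [set enorm (x - y) | y in E].

(* The extra point 0 sets the diameter of the empty set to 0. *)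
Definition ediam A : \bar R :=
  ereal_sup ([set 0%E] `|` [set (enorm (p.1 - p.2))%:E | p in A `*` A]).

Definition hausdorff_content (s delta : R) A : \bar R :=
  ereal_inf [set (\sum_(k <oo) ediam (U k) `^ s)%E | U in
    [set U : (set Rn)^nat |
      (forall k, (ediam (U k) <= delta%:E)%E) /\ A `<=` \bigcup_k U k]].

(* Without the dimensional normalising constant. *)
Definition hausdorff_measure (s : R) A : \bar R :=
  ereal_sup [set hausdorff_content s delta A | delta in [set t : R | 0 < t]].

Definition msupport (m : set Rn -> \bar R) : set Rn :=
  [set x | forall U, open U -> U x -> (0 < m U)%E].

(* [m] is a bare set function so as to cover both Borel measures and the
   restriction of the Hausdorff (outer) measure. *)
Definition ahlfors_regular_measure (d : R) E (m : set Rn -> \bar R) :=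
  [/\ closed E, msupport m = E, m (~` E) = 0%E &
    exists2 C : R, 1 <= C & forall Q (r : R), E Q -> 0 < r ->
      (r%:E < ediam E)%E ->
      ((C^-1 * r `^ d)%:E <= m (eball Q r) <= (C * r `^ d)%:E)%E].

Definition ahlfors_regular_set (d : R) E :=
  ahlfors_regular_measure d E (fun A => hausdorff_measure d (A `&` E)).

End euclidean.

Section sobolev.
Context {R : realType} {n : nat}.
Local Notation Rn := 'rV[R]_n.
Implicit Types (O E : set Rn) (u phi : Rn -> R) (G : Rn -> Rn).

Definition partial (i : 'I_n) u : Rn -> R := 'D_(delta_mx ord0 i) u.

Definition grad u : Rn -> Rn := fun x => \row_i partial i u x.

Fixpoint Ck (k : nat) u : Prop :=
  if k is k'.+1 then
    continuous u /\
    forall i, (forall x, derivable u x (delta_mx ord0 i)) /\ Ck k' (partial i u)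
  else continuous u.

Definition smooth u := forall k, Ck k u.

Definition test_function O phi :=
  smooth phi /\
  exists K, [/\ compact K, K `<=` O & forall x, ~ K x -> phi x = 0].

Definition L1loc O u :=
  forall K, compact K -> K `<=` O -> (@leb R n).-integrable K (EFin \o u).

(* [G] is the distributional gradient of [u] on [O]. *)
Definition weak_gradient O u G :=
  forall i, L1loc O (fun x => G x ord0 i) /\
    forall phi, test_function O phi ->
      (\int[@leb R n]_(x in O) (u x * partial i phi x)%:E =
       - \int[@leb R n]_(x in O) (G x ord0 i * phi x)%:E)%E.

(* The space W for the weight delta^-(n-d-1). *)
Definition W (d : R) E u :=
  L1loc (~` E) u /\
  exists2 G, weak_gradient (~` E) u G &
    (\int[@leb R n]_(x in ~` E)
      (dotv (G x) (G x) * edist x E `^ (- (n%:R - d - 1)))%:E < +oo)%E.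

Definition Wr (d : R) E O u :=
  L1loc O u /\
  forall phi, test_function O phi -> W d E (fun x => phi x * u x).

End sobolev.

Section green_function_at_infinity.
Context {R : realType} {n : nat}.
Local Notation Rn := 'rV[R]_n.
Variables (d : R) (E : set Rn) (mu : {measure set Rn -> \bar R}) (beta : R).
Implicit Types (u phi : Rn -> R) (G : Rn -> Rn).

(* Only meaningful off [E]. *)
Definition Dmu (x : Rn) : R :=
  (\int[mu]_(y in E) (enorm (x - y) `^ (- d - beta))) `^ (- beta^-1).

(* Extended-valued, so that equality with a finite quantity entails
   absolute convergence. *)
Definition energy G phi : \bar R :=
  (\int[@leb R n]_(x in ~` E)
    (Dmu x `^ (- (n%:R - d - 1)) * dotv (G x) (grad phi x))%:E)%E.

(* L_{mu,beta} u = 0 in the complement of [E]. *)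
Definition weak_solution u :=
  exists2 G, weak_gradient (~` E) u G &
    forall phi, test_function (~` E) phi -> energy G phi = 0%E.

Definition locally_finite (m : {measure set Rn -> \bar R}) :=
  forall x, exists U, [/\ open U, U x & (m U < +oo)%E].

(* Sign: for a solution [u > 0] that vanishes on [E] and a positive [omega],
   the energy equals MINUS the integral against [omega] (e.g. [u = x_+] on the
   half-line: the integral of [phi'] over x > 0 is [- phi 0]); equivalently,
   -L_{mu,beta} u = omega in the sense of distributions. *)
Definition harmonic_measure_of u (omega : {measure set Rn -> \bar R}) :=
  exists2 G, weak_gradient (~` E) u G &
    forall phi, test_function setT phi ->
      energy G phi = (- \int[omega]_(x in E) (phi x)%:E)%E.

Definition green_pair_at_infinity u (omega : {measure set Rn -> \bar R}) :=
  [/\ (forall Q (r : R), E Q -> 0 < r -> Wr d E (eball Q r) u) /\ continuous u,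
      (forall x, ~ E x -> 0 < u x) /\ (forall x, E x -> u x = 0),
      weak_solution u,
      locally_finite omega /\ omega (~` E) = 0%E &
      harmonic_measure_of u omega].

Definition green_function_at_infinity u :=
  exists omega, green_pair_at_infinity u omega.

End green_function_at_infinity.

(* Main.v *)
Require Import Defs.
From HB Require Import structures.
From mathcomp Require Import all_boot all_order all_algebra.
From mathcomp Require Import all_classical all_reals all_analysis.
From mathcomp Require Import measurable_realfun.
From mathcomp Require Import ring lra.

(** With [h x = \int |x - y|^(2 - n) dmu(y)], harmonic off [E], and
    [alpha = n - d - 2], one has [D = h^(-1/alpha)], so that
    [D^-(n-d-1) * grad D = - (1/alpha) * grad h]: the degenerate operator turns
    the equation for [D] into the Laplace equation for [h].  Since [|x|^(2 - n)]
    is a multiple of the fundamental solution of the Laplacian, the energy of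
    [D] against [phi] is, by Fubini, a negative multiple of [\int phi dmu];
    thus the harmonic measure with pole at infinity is a multiple of [mu].

    The fundamental solution is obtained without surface integrals: the fields
    [z / (|z|^2 + e)^(n/2)] have divergence [n e (|z|^2 + e)^(-n/2-1)], an
    approximate identity of constant mass as [e] tends to 0.  Integration by
    parts comes from translation invariance of Lebesgue measure and dominated
    convergence of difference quotients.  Ahlfors regularity enters through
    dyadic decompositions, which compare [\int |x - y|^-t dmu(y)] with
    [dist(x, E)^(d-t)] for [t > d]; by Tonelli, with [t = n - 1], the weight
    [dist(x, E)^-(n-d-1)] is locally integrable. *)

(** The value [alpha = n - d - 2] is singled out by powers of [h]: the weight is [D^-(n-d-1) =
    h^((n-d-1)/alpha) = h^(1/alpha + 1)], and the chain rule puts [h^(-1/alpha - 1)] in front of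
    [grad h], so the two cancel exactly. The obstacle is the boundary, where [h] blows up like
    [dist(x, E)^-alpha] and [grad h] may grow like [dist(x, E)^-(n-d-1)]. No cutoff near [E] is
    made: this growth is exactly that of the weight, whose local integrability justifies Fubini up
    to the boundary, and the lower bound on [h] turns it into a uniform bound on [grad D], which
    puts the cutoffs of [D] in [W]. The kernel identity holds on all of [R^n] while the energy lives
    off [E], so [E] also has to be Lebesgue null; this comes from measuring the pairs [(x, y)] with
    [|x - y| < q] by Lebesgue measure in [x] and [mu] in [y], as [q] tends to 0. *)

Set Implicit Arguments.
Unset Strict Implicit.
Unset Printing Implicit Defensive.

Import Order.TTheory GRing.Theory Num.Theory.
Import numFieldNormedType.Exports.

Local Open Scope classical_set_scope.
Local Open Scope ring_scope.

(** * The Euclidean norm *)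

Section euclidean_norm.
Context {R : realType} {n : nat}.
Implicit Types x y z : 'rV[R]_n.

Lemma dotv_ge0 x : 0 <= dotv x x.
Proof. by apply: sumr_ge0 => i _; rewrite -expr2 sqr_ge0. Qed.

Lemma enorm_ge0 x : 0 <= enorm x.
Proof. exact: sqrtr_ge0. Qed.

Lemma sqr_enorm x : enorm x ^+ 2 = dotv x x.
Proof. by rewrite sqr_sqrtr// dotv_ge0. Qed.

Lemma coord_le_enorm x i : `|x ord0 i| <= enorm x.
Proof.
rewrite -sqrtr_sqr ler_sqrt ?dotv_ge0// /dotv (bigD1 i)//= -expr2 lerDl.
by apply: sumr_ge0 => j _; rewrite -expr2 sqr_ge0.
Qed.

Lemma enorm0_eq0 x : enorm x = 0 -> x = 0.
Proof.
move=> x0; apply/rowP => i; rewrite mxE; apply/eqP.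
by rewrite -normr_le0 -x0 coord_le_enorm.
Qed.

Lemma enorm0 : enorm (0 : 'rV[R]_n) = 0.
Proof.
by rewrite /enorm /dotv big1 ?sqrtr0// => i _; rewrite !mxE mulr0.
Qed.

Lemma enorm_gt0 x : x != 0 -> 0 < enorm x.
Proof.
rewrite lt_def enorm_ge0 andbT; apply: contra => /eqP.
by move/enorm0_eq0 => ->.
Qed.

Lemma enormN x : enorm (- x) = enorm x.
Proof.
by rewrite /enorm /dotv; congr Num.sqrt; apply: eq_bigr => i _; rewrite !mxE mulrNN.
Qed.

Lemma enormB x y : enorm (x - y) = enorm (y - x).
Proof. by rewrite -enormN opprB. Qed.

Lemma enormZ (a : R) x : enorm (a *: x) = `|a| * enorm x.
Proof.
rewrite /enorm -sqrtr_sqr -sqrtrM ?sqr_ge0//; congr Num.sqrt.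
rewrite /dotv mulr_sumr; apply: eq_bigr => i _; rewrite !mxE; ring.
Qed.

(** Cauchy-Schwarz: with [Z], [W] the two norms, the sum of the squares [(z_i W - Z w_i)^2] equals
    [2 Z W (Z W - dotv z w)]. The lower bound follows by changing the sign of [x]. *)
Lemma dotv_le x y : `|dotv x y| <= enorm x * enorm y.
Proof.
have H z w : dotv z w <= enorm z * enorm w.
  have [z0|z0] := eqVneq z 0.
    rewrite z0 enorm0 mul0r /dotv big1// => i _.
    by rewrite mxE mul0r.
  have [w0|w0] := eqVneq w 0.
    rewrite w0 enorm0 mulr0 /dotv big1// => i _.
    by rewrite mxE mulr0.
  have zw : 0 < enorm z * enorm w by rewrite mulr_gt0 ?enorm_gt0.
  rewrite -(ler_pM2l zw) -(ler_pM2l (_ : 0 < 2))//.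
  set Z := enorm z; set W := enorm w.
  have -> : 2 * (Z * W * (Z * W)) = dotv z z * W ^+ 2 + Z ^+ 2 * dotv w w.
    by rewrite -!sqr_enorm -/Z -/W; ring.
  rewrite /dotv mulr_suml !mulr_sumr -big_split/= ler_sum// => i _.
  rewrite -subr_ge0.
  rewrite (_ : _ - _ = (z ord0 i * W - Z * w ord0 i) ^+ 2) ?sqr_ge0//; ring.
rewrite ler_norml H andbT lerNl.
rewrite (_ : - dotv x y = dotv (- x) y); first by rewrite -(enormN x) H.
by rewrite /dotv -sumrN; apply: eq_bigr => i _; rewrite !mxE mulNr.
Qed.

Lemma ler_enormD x y : enorm (x + y) <= enorm x + enorm y.
Proof.
rewrite -(@ler_pXn2r _ 2) ?nnegrE ?addr_ge0 ?enorm_ge0//.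
rewrite sqr_enorm sqrrD.
have -> : dotv (x + y) (x + y) = dotv x x + dotv x y *+ 2 + dotv y y.
  rewrite /dotv -sumrMnl -!big_split/=; apply: eq_bigr => i _; rewrite !mxE; ring.
rewrite !sqr_enorm lerD2r lerD2l lerMn2r orFb.
exact: le_trans (ler_norm _) (dotv_le x y).
Qed.

Lemma ler_enormB3 x y z : enorm (x - z) <= enorm (x - y) + enorm (y - z).
Proof. by rewrite (_ : x - z = (x - y) + (y - z)) ?ler_enormD// addrA subrK. Qed.

Lemma norm_le_enorm x : `|x| <= enorm x.
Proof.
rewrite [leLHS]/Num.Def.normr/= mx_normrE (bigmax_le _ (enorm_ge0 x))//=.
by move=> -[i j] _; rewrite (ord1 i) coord_le_enorm.
Qed.

Lemma coord_le_norm x i : `|x ord0 i| <= `|x|.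
Proof.
rewrite [leRHS]/Num.Def.normr/= mx_normrE.
by apply/bigmax_geP; right => /=; exists (ord0, i).
Qed.

(** The constant [n], cruder than its square root, comes from passing through the sum of the
    [|x_i|]; it is good enough to compare topologies and bounded sets. *)
Lemma enorm_le_norm x : enorm x <= n%:R * `|x|.
Proof.
have : \sum_(i < n) `|x ord0 i| <= n%:R * `|x|.
  apply: (@le_trans _ _ (\sum_(i < n) `|x|)); last first.
    by rewrite sumr_const card_ord mulr_natl.
  by apply: ler_sum => i _; exact: coord_le_norm.
apply: le_trans.
have s0 (P : pred 'I_n) : 0 <= \sum_(i < n | P i) `|x ord0 i|.
  by apply: sumr_ge0 => j _.
rewrite -(@ler_pXn2r _ 2) ?nnegrE ?enorm_ge0//.
rewrite sqr_enorm expr2 mulr_suml; apply: ler_sum => i _.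
rewrite -expr2 -[_ ^+ 2]ger0_norm ?sqr_ge0// normrX expr2 ler_wpM2l//.
by rewrite (bigD1 i)//= lerDl.
Qed.

End euclidean_norm.

(** * Euclidean balls in the topology of the maximum norm *)

Section euclidean_topology.
Context {R : realType} {n : nat}.
Implicit Types x y z : 'rV[R]_n.

Lemma near_enorm x (e : R) : 0 < e -> \forall y \near x, enorm (y - x) < e.
Proof.
(* Dividing by [n.+1] rather than [n] covers dimension 0. *)
move=> e0; have ne : 0 < e / n.+1%:R by rewrite divr_gt0.
near=> y.
apply: le_lt_trans (enorm_le_norm _) _.
have : `|x - y| < e / n.+1%:R.
  by near: y; exact: cvgr_dist_lt.
rewrite distrC ltr_pdivlMr// mulrC; apply: le_lt_trans.
by rewrite ler_wpM2r// ler_nat.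
Unshelve. all: by end_near. Qed.

Lemma nearP_enorm x (P : set 'rV[R]_n) :
  nbhs x P <-> exists2 e : R, 0 < e & forall y, enorm (y - x) < e -> P y.
Proof.
split=> [/nbhs_ballP[e /= e0 eP]|[e e0 eP]]; last first.
  by apply: filterS (near_enorm x e0) => y /eP.
exists e => // y yx; apply: eP; rewrite -ball_normE /ball_/= distrC.
exact: le_lt_trans (norm_le_enorm _) yx.
Qed.

Lemma eball_open x (r : R) : open (eball x r).
Proof.
rewrite openE => y /= yr; apply/nearP_enorm.
exists (r - enorm (y - x)); first by rewrite subr_gt0.
move=> z; rewrite ltrBrDr => zy; rewrite /eball/=.
exact: le_lt_trans (ler_enormB3 z y x) zy.
Qed.

Lemma measurable_eball x (r : R) : measurable (eball x r).
Proof. by apply: open_measurable_rV; exact: eball_open. Qed.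

Lemma closed_measurable_rV (A : set 'rV[R]_n) : closed A -> measurable A.
Proof.
move=> cA; rewrite -[A]setCK; apply: measurableC; apply: open_measurable_rV.
exact: closed_openC.
Qed.

Lemma measurable_fun_open_continuous (O : set 'rV[R]_n) (f : 'rV[R]_n -> R) :
  open O -> (forall x, O x -> {for x, continuous f}) -> measurable_fun O f.
Proof.
move=> oO cf; apply: (measurability _ (RGenOInfty.measurableE R)).
move=> _ [_ [a ->] <-].
apply: open_measurable_rV.
suff H (A : set 'rV[R]_n) : (forall x, A x -> nbhs x A) -> open A.
  apply: H => x [Ox /=]; rewrite in_itv/= andbT => ax.
  near=> y; split; first by near: y; exact: open_nbhs_nbhs.
  rewrite /= in_itv/= andbT; near: y.
  exact: (cvgr_gt _ (cf x Ox)).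
by move=> AN; rewrite openE.
Unshelve. all: by end_near. Qed.

Lemma continuous_measurable_rV (f : 'rV[R]_n -> R) (D : set 'rV[R]_n) :
  continuous f -> measurable_fun D f.
Proof.
move=> cf; apply: measurable_funTS.
apply: measurable_fun_open_continuous => [|x _]; last exact: cf.
exact: (@openT 'rV[R]_n).
Qed.

Lemma enorm_lipschitz x y : `|enorm x - enorm y| <= enorm (x - y).
Proof.
rewrite ler_norml lerNl opprB !lerBlDr; apply/andP; split.
  by rewrite enormB -{1}(subrK x y) ler_enormD.
by rewrite -{1}(subrK y x) ler_enormD.
Qed.

Lemma enorm_continuous : continuous (@enorm R n).
Proof.
move=> x; apply/(@cvgrPdist_lt _ R^o _ (nbhs x)) => e e0; near=> y.
apply: le_lt_trans (enorm_lipschitz x y) _; rewrite enormB.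
by near: y; exact: near_enorm.
Unshelve. all: by end_near. Qed.

Lemma bounded_enorm (A : set 'rV[R]_n) : bounded_set A ->
  exists2 M : R, 0 < M & forall x, A x -> enorm x < M.
Proof.
move=> [M [_ AM]]; exists (n%:R * `|M + 1| + 1) => [|x Ax].
  by rewrite ltr_wpDl// mulr_ge0.
rewrite ltr_pwDr//; apply: le_trans (enorm_le_norm x) _.
rewrite ler_wpM2l//; apply: le_trans (ler_norm _).
by apply: AM Ax; rewrite ltrDl.
Qed.

Lemma compact_enorm (A : set 'rV[R]_n) : compact A ->
  exists2 M : R, 0 < M & forall x, A x -> enorm x < M.
Proof. by move=> /compact_bounded/bounded_enorm. Qed.

End euclidean_topology.

(** * Lebesgue measure under affine maps *)

Section lebesgue_affine.
Local Open Scope ereal_scope.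
Context {R : realType}.
Implicit Types a b : R.

Lemma measurable_affine (a b : R) : measurable_fun setT
  (fun t : measurableTypeR R => a * t + b : measurableTypeR R)%R.
Proof. by apply: measurable_funD => //; exact: measurable_funM. Qed.

(** By uniqueness of Lebesgue measure: [a] times its image under the affine map [phi] agrees with it
    on half-open intervals, hence on all measurable sets. *)
Lemma ge0_integral_lebesgue_affine (a b : R) (f : measurableTypeR R -> \bar R) :
  (0 < a)%R ->
  measurable_fun setT f -> (forall t, 0 <= f t) ->
  \int[@lebesgue_measure R]_t f (a * t + b)%R =
  (a^-1)%:E * \int[@lebesgue_measure R]_t f t.
Proof.
move=> a0 mf f0.
have a0' : (0 <= a)%R := ltW a0.
pose phi := fun t : measurableTypeR R => (a * t + b)%R : measurableTypeR R.
have mphi : measurable_fun setT phi by exact: measurable_affine.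
pose P : {measure set (measurableTypeR R) -> \bar R} :=
  measure_function_pushforward__canonical__measure_function_Measure
    (@lebesgue_measure R) mphi.
pose nu : {measure set (measurableTypeR R) -> \bar R} := mscale (NngNum a0') P.
have E A : measurable A -> @lebesgue_measure R A = nu A.
  apply: lebesgue_measure_unique => _ [[x y] _ <-] /=.
  rewrite /nu /mscale/= /pushforward.
  have -> : phi @^-1` [set` `]x, y]] = [set` `](x - b) / a, (y - b) / a]]%R.
    apply/seteqP; split=> t /=; rewrite !in_itv/= /phi ltr_pdivrMr// ler_pdivlMr//;
    by rewrite ltrBlDr lerBrDr (mulrC t).
  rewrite !lebesgue_measure_itv/= !lte_fin ltr_pM2r ?invr_gt0// ltrD2r.
  case: ifPn => _; last by rewrite mule0.
  by rewrite -!EFinD -EFinM; congr EFin; field; rewrite gt_eqF.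
have -> : \int[@lebesgue_measure R]_t f t = \int[nu]_t f t.
  by apply: eq_measure_integral => A mA _; exact: E.
rewrite ge0_integral_mscale//= ge0_integral_pushforward//.
by rewrite muleA -EFinM mulVf ?gt_eqF// mul1e.
Qed.

End lebesgue_affine.

Section leb_affine.
Local Open Scope ereal_scope.
Context {R : realType}.

(** Tonelli applied to the recursive definition of [leb]; this is the induction step for facts about
    integrals on [R^n]. *)
Lemma ge0_integral_leb_succ m (f : 'rV[R]_m.+1 -> \bar R) :
  measurable_fun setT f -> (forall x, 0 <= f x) ->
  \int[@leb R m.+1]_x f x =
  \int[@lebesgue_measure R]_t \int[@leb R m]_x f (consrV (t, x)).
Proof.
move=> mf f0.
have -> : \int[@leb R m.+1]_x f x =
    \int[@lebesgue_measure R \x @leb R m]_p f (consrV p).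
  rewrite -[LHS]/(\int[pushforward (@lebesgue_measure R \x @leb R m)
    (@consrV R m)]_x f x).
  by rewrite ge0_integral_pushforward//; exact: measurable_consrV.
rewrite (@fubini_tonelli1 _ _ _ _ _ (@lebesgue_measure R) (@leb R m) (f \o @consrV R m))//.
- by apply: measurableT_comp => //; exact: measurable_consrV.
- by move=> p; exact: f0.
Qed.

Lemma consrV_affine m (a : R) (v : 'rV[R]_m.+1) t (x : 'rV[R]_m) :
  (a *: consrV (t, x) + v =
   consrV (a * t + v ord0 ord0, a *: x + \row_j v ord0 (rshift 1 j)))%R.
Proof.
apply/rowP => i; rewrite /consrV !mxE/=.
rewrite -[i](@splitK 1 m); case: (fintype.split (i : 'I_(1 + m))) => k.
  rewrite !unsplitK/= !mxE (ord1 k) !mulr1n.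
  by congr (_ + v _ _)%R; apply/val_inj.
by rewrite !unsplitK/= !mxE.
Qed.

Lemma affine_continuous n (a : R) (v : 'rV[R]_n) :
  continuous (fun x : 'rV[R]_n => a *: x + v)%R.
Proof.
move=> x; have H : continuous (fun x : 'rV[R]_n => a *: x)%R.
  exact: scaler_continuous.
exact: (@cvgD _ _ _ _ _ (fun x => a *: x)%R (fun=> v) _ _ (H x) (cvg_cst v)).
Qed.

Lemma measurable_affine_rV n (a : R) (v : 'rV[R]_n) :
  measurable_fun setT (fun x : 'rV[R]_n => a *: x + v)%R.
Proof.
apply: (@measurability _ _ _ _ _ _ (@open 'rV[R]_n)) => //.
move=> _ [U oU <-]; rewrite setTI; apply: open_measurable_rV.
by apply: open_comp => // x _; exact: affine_continuous.
Qed.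

Lemma measurable_consrV2 m t : measurable_fun setT (fun x : 'rV[R]_m => consrV (t, x)).
Proof.
apply: (measurableT_comp (@measurable_consrV R m)).
exact: measurable_pair1.
Qed.

(** Each coordinate contributes one factor [a^-1]. Translations ([a = 1]) serve integration by
    parts, and dilations ([v = 0]) the rescaling of the approximate identity. *)
Lemma ge0_integral_leb_affine n (a : R) (v : 'rV[R]_n) (f : 'rV[R]_n -> \bar R) :
  (0 < a)%R -> measurable_fun setT f -> (forall x, 0 <= f x) ->
  \int[@leb R n]_x f (a *: x + v)%R = (a ^- n)%:E * \int[@leb R n]_x f x.
Proof.
move=> a0; elim: n v f => [|m IH] v f mf f0.
  rewrite expr0 invr1 mul1e; apply: eq_integral => x _; congr f.
  by apply/rowP => -[].
rewrite [LHS]ge0_integral_leb_succ//; last first.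
  by apply: (measurableT_comp mf); exact: measurable_affine_rV.
pose F t := \int[@leb R m]_x f (consrV (t, x)).
have mF : measurable_fun setT F.
  apply: (measurable_fun_fubini_tonelli_F (f \o @consrV R m)) => //.
    by apply: measurableT_comp => //; exact: measurable_consrV.
  by move=> p; exact: f0.
have F0 t : 0 <= F t by exact: integral_ge0.
transitivity (\int[@lebesgue_measure R]_t
    ((a ^- m)%:E * F (a * t + v ord0 ord0)%R)).
  apply: eq_integral => t _.
  under eq_integral do rewrite consrV_affine.
  rewrite (IH _ (fun x => f (consrV ((a * t + v ord0 ord0)%R, x))))//.
  by apply: (measurableT_comp mf); exact: measurable_consrV2.
rewrite ge0_integralZl//; last 2 first.
- by apply: (measurableT_comp mF); exact: measurable_affine.
- by rewrite lee_fin invr_ge0 exprn_ge0// ltW.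
rewrite ge0_integral_lebesgue_affine//.
by rewrite muleA -EFinM -invfM -exprSr ge0_integral_leb_succ.
Qed.

Lemma integral_leb_affine n (a : R) (v : 'rV[R]_n) (f : 'rV[R]_n -> \bar R) :
  (0 < a)%R -> (@leb R n).-integrable setT f ->
  \int[@leb R n]_x f (a *: x + v)%R = (a ^- n)%:E * \int[@leb R n]_x f x.
Proof.
move=> a0 fi; have mf := measurable_int _ fi.
rewrite [in RHS]integralE [LHS]integralE muleBr//; last first.
  apply: fin_num_adde_defr; apply: integrable_fin_num => //.
  exact: integrable_funepos.
have Hp := ge0_integral_leb_affine v a0 (measurable_funepos mf) (fun x => funepos_ge0 f x).
have Hn := ge0_integral_leb_affine v a0 (measurable_funeneg mf) (fun x => funeneg_ge0 f x).
by rewrite -Hp -Hn; congr (_ - _); apply: eq_integral => x _; rewrite ?funeposE ?funenegE.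
Qed.

(** Balls of the maximum norm are cubes, that is, products of intervals of length [2 r]. *)
Lemma leb_ball n (y : 'rV[R]_n) (r : R) : (0 < r)%R ->
  @leb R n (ball y r) <= ((2 * r) ^+ n)%:E.
Proof.
move=> r0; elim: n y => [|m IH] y.
  by rewrite expr0 /leb diracE; case: (_ \in _).
have -> : y = consrV (y ord0 ord0, \row_j y ord0 (rshift 1 j)).
  (* Taking the scalar 0 in [consrV_affine] splits [y] into its first coordinate and the rest. *)
  have := consrV_affine 0%R y 0%R 0%R.
  by rewrite !scale0r mul0r !add0r.
have cE (p : R * 'rV[R]_m) :
    (@consrV R m) @^-1` ball (consrV p) r = ball p.1 r `*` ball p.2 r.
  apply/seteqP; split=> q; rewrite /preimage /=.
    exact: (consrV_ball p q r).1.
  exact: (consrV_ball p q r).2.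
rewrite -[leLHS]/((@lebesgue_measure R \x @leb R m)
  ((@consrV R m) @^-1` ball _ r)) cE.
rewrite product_measure1E; last 2 first.
  exact: measurable_ball.
  by apply: open_measurable_rV; exact: ball_open.
have lb := lebesgue_measure_ball (y ord0 ord0) (ltW r0).
rewrite -[X in X * _]/(lebesgue_measure (ball (y ord0 ord0) r)) lb.
rewrite exprS EFinM.
by apply: lee_pmul => //;
  [rewrite lee_fin mulrn_wge0// ltW|rewrite lee_fin mulr_natl|exact: IH].
Qed.

Lemma leb_eball n (y : 'rV[R]_n) (r : R) : (0 < r)%R ->
  @leb R n (eball y r) <= ((2 * r) ^+ n)%:E.
Proof.
move=> r0; apply: le_trans (leb_ball y r0).
apply: le_measure; rewrite ?inE; first exact: measurable_eball.
  by apply: open_measurable_rV; exact: ball_open.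
move=> z; rewrite /eball/= => zr.
rewrite -ball_normE /ball_/= distrC.
exact: le_lt_trans (norm_le_enorm _) zr.
Qed.

End leb_affine.

(** * Dyadic estimates *)

Section dyadic.
Local Open Scope ereal_scope.
Context {R : realType}.

Lemma nneseries_geometric (M z : R) : (0 <= M)%R -> (0 <= z < 1)%R ->
  \sum_(k <oo) (M * z ^+ k)%:E = (M / (1 - z))%:E.
Proof.
move=> M0 /andP[z0 z1]; apply/cvg_lim => //.
rewrite (_ : (fun n => _) = EFin \o series (geometric M z)).
  apply: cvg_EFin; first exact: nearW.
  by apply: cvg_geometric_series; rewrite ger0_norm.
by apply/funext => k /=; rewrite /series/= -sumEFin.
Qed.

(** On [D], [f] is at most the sum of the [a k * \1_(A k)]. The pieces may overlap and may leave
    [D], so full balls can be used in place of shells. *)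
Lemma ge0_integral_cover d (T : measurableType d) (m : {measure set T -> \bar R})
    (D : set T) (f : T -> R) (A : (set T)^nat) (a : R^nat) :
  measurable D -> measurable_fun D f -> (forall x, D x -> 0 <= f x)%R ->
  (forall k, measurable (A k)) -> (forall k, 0 <= a k)%R ->
  (forall x, D x -> exists2 k, A k x & (f x <= a k)%R) ->
  \int[m]_(x in D) (f x)%:E <= \sum_(k <oo) (a k)%:E * m (A k).
Proof.
move=> mD mf f0 mA a0 H.
apply: (@le_trans _ _ (\int[m]_(x in D) \sum_(k <oo) (a k * \1_(A k) x)%:E)).
  apply: ge0_le_integral => //.
  - exact/measurable_EFinP.
  - apply: ge0_emeasurable_sum => [k x _ _|k _].
      by rewrite lee_fin mulr_ge0.
    by apply/measurable_EFinP; apply: measurable_funM => //; exact: measurable_indic.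
  - move=> x Dx; have [k Akx fk] := H _ Dx.
    apply: (@le_trans _ _ (\sum_(0 <= i < k.+1) (a i * \1_(A i) x)%:E)).
      rewrite big_nat_recr//= [(\1_ _ _)%R]indicE mem_set// mulr1.
      apply: (@le_trans _ _ (a k)%:E); first by rewrite lee_fin.
      by rewrite leeDr// sume_ge0// => i _; rewrite lee_fin mulr_ge0.
    by apply: nneseries_lim_ge => i _; rewrite lee_fin mulr_ge0.
rewrite integral_nneseries//; last 2 first.
- by move=> k; apply/measurable_EFinP; exact: measurable_funM.
- by move=> k x _; rewrite lee_fin mulr_ge0.
apply: lee_nneseries => [k _ _|k _].
  by apply: integral_ge0 => x _; rewrite lee_fin mulr_ge0.
under eq_integral do rewrite EFinM.
rewrite ge0_integralZl_EFin//; last first.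
  by apply/measurable_EFinP; exact: measurable_indic.
rewrite integral_indic//; apply: lee_wpmul2l; first by rewrite lee_fin.
by apply: le_measure; rewrite ?inE//; exact: measurableI.
Qed.

End dyadic.

Section dyadic_potential.
Context {R : realType} {n : nat}.
Implicit Types (x y : 'rV[R]_n) (D : set 'rV[R]_n).

Lemma dyadic_scale (rho r : R) : 0 < rho -> rho <= r ->
  exists k, 2 ^+ k * rho <= r < 2 ^+ k.+1 * rho.
Proof.
move=> rho0 rr.
have ex : exists k, r < 2 ^+ k.+1 * rho.
  exists (Num.truncn (r / rho)); rewrite -ltr_pdivrMr//.
  apply: lt_le_trans (truncnS_gt _) _.
  by rewrite -natrX ler_nat ltnW// ltn_expl.
have [[|k] kP kmin] := ex_minnP ex.
  by exists 0%N; rewrite expr0 mul1r rr kP.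
exists k.+1; rewrite kP andbT leNgt; apply/negP => /kmin.
by rewrite ltnn.
Qed.

Lemma measurable_enorm_sub x (D : set 'rV[R]_n) (t : R) :
  measurable_fun D (fun y : 'rV[R]_n => enorm (x - y) `^ t).
Proof.
apply: measurable_funTS; apply: (measurableT_comp (measurable_powR _)).
apply: continuous_measurable_rV => y.
apply: (@continuous_comp _ _ _ (fun y => x - y)).
  have -> : (fun y => x - y) = (fun y => (-1) *: y + x).
    by apply/funext => w; rewrite scaleN1r addrC.
  exact: affine_continuous.
exact: enorm_continuous.
Qed.

Lemma powR2n (s : R) k : (2 ^+ k) `^ s = (2 `^ s) ^+ k.
Proof. by rewrite -powR_mulrn// -powRrM mulrC powRrM powR_mulrn// powR_ge0. Qed.

(** The shell between the radii [2^k rho] and [2^(k+1) rho] contributes at most a multiple of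
    [rho^(s-t) 2^(k(s-t))], a geometric series since [s < t]. [K] is chosen before [m], [x], [rho]
    and [D], so the bound is uniform in them. It is used with [s = d] for [mu] and with [s = n] for
    Lebesgue measure. *)
Lemma dyadic_outer (C s t : R) : 0 <= C -> s < t -> 0 <= t ->
  exists2 K : R, 0 <= K & forall (m : {measure set 'rV[R]_n -> \bar R}) x rho D,
    0 < rho ->
    (forall r, rho <= r -> (m (eball x r) <= (C * r `^ s)%:E)%E) ->
    measurable D -> (forall y, D y -> rho <= enorm (x - y)) ->
    (\int[m]_(y in D) (enorm (x - y) `^ (- t))%:E <= (K * rho `^ (s - t))%:E)%E.
Proof.
move=> C0 st t0.
pose z : R := 2 `^ (s - t).
have z0 : 0 < z by exact: powR_gt0.
have z1 : z < 1.
  rewrite /z -opprB powRN invf_lt1 ?powR_gt0//.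
  have := @gt0_ltr_powR R (t - s); rewrite subr_gt0 => /(_ st 1 2).
  by rewrite powR1 !nnegrE ltr1n; apply.
exists (C * 2 `^ s / (1 - z)).
  by rewrite divr_ge0 ?mulr_ge0 ?powR_ge0// subr_ge0 ltW.
move=> m x rho D rho0 mC mD Drho.
apply: (@le_trans _ _ (\sum_(k <oo) (C * 2 `^ s * rho `^ (s - t) * z ^+ k)%:E)%E);
  last first.
  rewrite nneseries_geometric ?(ltW z0) ?z1//; last by rewrite !mulr_ge0 ?powR_ge0.
  by rewrite lee_fin mulrAC.
apply: (@le_trans _ _ (\sum_(k <oo) ((2 ^+ k * rho) `^ (- t))%:E *
    m (eball x (2 ^+ k.+1 * rho)))%E).
  apply: ge0_integral_cover => //.
  - exact: measurable_enorm_sub.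
  - by move=> *; exact: powR_ge0.
  - by move=> k; exact: measurable_eball.
  - by move=> k; exact: powR_ge0.
  - move=> y Dy; have [k /andP[k1 k2]] := dyadic_scale rho0 (Drho _ Dy).
    exists k; first by rewrite /eball/= enormB.
    have p1 : 0 < 2 ^+ k * rho by rewrite mulr_gt0 ?exprn_gt0.
    rewrite !powRN lef_pV2 ?posrE ?powR_gt0//; last exact: lt_le_trans k1.
    by apply: ge0_ler_powR => //; rewrite nnegrE ?enorm_ge0 ?(ltW p1).
apply: lee_nneseries => [k _ _|k _].
  by rewrite mule_ge0// lee_fin powR_ge0.
have r0 : rho <= 2 ^+ k.+1 * rho.
  by rewrite ler_peMl ?(ltW rho0)// exprn_ege1// ler1n.
apply: le_trans (lee_wpmul2l _ (mC _ r0)) _; first by rewrite lee_fin powR_ge0.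
rewrite -EFinM lee_fin.
have h2 : (0 : R) <= 2 ^+ k by rewrite exprn_ge0.
rewrite exprS !powRM ?(ltW rho0) ?mulr_ge0//.
rewrite !powR2n /z (powRD (x := 2)); last by rewrite pnatr_eq0 implybT.
rewrite (powRD (x := rho)); last by rewrite (gt_eqF rho0) implybT.
rewrite exprMn le_eqVlt; apply/orP; left; apply/eqP; ring.
Qed.

(** The counterpart near the pole: the shells now shrink towards [x], and the series converges
    because [t < s]. *)
Lemma dyadic_inner (C s t : R) : 0 <= C -> t < s -> 0 < t ->
  exists2 K : R, 0 <= K & forall (m : {measure set 'rV[R]_n -> \bar R}) x rho D,
    0 < rho ->
    (forall r, 0 < r -> (m (eball x r) <= (C * r `^ s)%:E)%E) ->
    measurable D -> (forall y, D y -> enorm (x - y) < rho) ->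
    (\int[m]_(y in D) (enorm (x - y) `^ (- t))%:E <= (K * rho `^ (s - t))%:E)%E.
Proof.
move=> C0 st t0.
pose z : R := 2^-1 `^ (s - t).
have z0 : 0 < z by apply: powR_gt0; rewrite invr_gt0.
have z1 : z < 1.
  have := @gt0_ltr_powR R (s - t); rewrite subr_gt0 => /(_ st 2^-1 1).
  by rewrite powR1 !nnegrE invr_ge0 invf_lt1// ltr1n; apply.
exists (C * 2 `^ s * 2 `^ t / (1 - z)).
  by rewrite divr_ge0 ?mulr_ge0 ?powR_ge0// subr_ge0 ltW.
move=> m x rho D rho0 mC mD Drho.
apply: (@le_trans _ _ (\sum_(k <oo) (C * 2 `^ s * 2 `^ t * rho `^ (s - t) * z ^+ k)%:E)%E);
  last first.
  rewrite nneseries_geometric ?(ltW z0) ?z1//; last by rewrite !mulr_ge0 ?powR_ge0.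
  by rewrite lee_fin mulrAC.
have rk0 k : 0 < 2^-1 ^+ k * rho by rewrite mulr_gt0 ?exprn_gt0.
(* The radius carries an extra factor 2 because [dyadic_scale] only gives [|x - y| <= 2^-k rho],
   while balls are open. *)
apply: (@le_trans _ _ (\sum_(k <oo) ((2^-1 ^+ k.+1 * rho) `^ (- t))%:E *
    m (eball x (2 * (2^-1 ^+ k * rho))))%E).
  apply: ge0_integral_cover => //.
  - exact: measurable_enorm_sub.
  - by move=> *; exact: powR_ge0.
  - by move=> k; exact: measurable_eball.
  - by move=> k; exact: powR_ge0.
  - move=> y Dy; have := enorm_ge0 (x - y).
    (* At [y = x] no shell applies, but there the integrand is 0, the value of [powR] at base 0 and
       nonzero exponent; the piece [k = 0] covers this point. *)
    rewrite le_eqVlt => /predU1P[xy|xy].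
      exists 0%N; first by rewrite /eball/= enormB -xy mulr_gt0.
      by rewrite -xy powR0 ?powR_ge0// oppr_eq0 gt_eqF.
    have [k /andP[k1 k2]] := dyadic_scale xy (ltW (Drho _ Dy)).
    have E j : 2^-1 ^+ j * (2 ^+ j * enorm (x - y)) = enorm (x - y).
      by rewrite mulrA -exprMn mulVf ?expr1n ?mul1r// pnatr_eq0.
    exists k.
      rewrite /eball/= enormB -(E k).
      apply: le_lt_trans (_ : 2^-1 ^+ k * rho < _).
        by rewrite ler_pM2l ?exprn_gt0.
      by rewrite ltr_pMl// ltr1n.
    have p1 := rk0 k.+1.
    rewrite !powRN lef_pV2 ?posrE ?powR_gt0//.
    apply: ge0_ler_powR; rewrite ?nnegrE ?enorm_ge0 ?(ltW p1) ?(ltW t0)//.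
    by rewrite -(E k.+1) ler_pM2l ?exprn_gt0// ltW.
apply: lee_nneseries => [k _ _|k _].
  by rewrite mule_ge0// lee_fin powR_ge0.
have r0 : 0 < 2 * (2^-1 ^+ k * rho) by rewrite mulr_gt0.
apply: le_trans (lee_wpmul2l _ (mC _ r0)) _; first by rewrite lee_fin powR_ge0.
rewrite -EFinM lee_fin.
have i0 : (0 : R) <= 2^-1 by rewrite invr_ge0.
have h2 : (0 : R) <= 2^-1 ^+ k by rewrite exprn_ge0.
have e j (w : R) : (2^-1 ^+ j) `^ w = (2^-1 `^ w) ^+ j.
  by rewrite -powR_mulrn// -powRrM mulrC powRrM powR_mulrn// powR_ge0.
rewrite exprS !powRM ?(ltW rho0) ?mulr_ge0//.
rewrite !e /z (powRD (x := 2^-1)); last by rewrite invr_eq0 pnatr_eq0 implybT.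
rewrite (powRD (x := rho)); last by rewrite (gt_eqF rho0) implybT.
have -> : (2^-1 : R) `^ (- t) = 2 `^ t.
  by rewrite -(powR_inv1 (ler0n R 2)) -powRrM mulrNN mul1r.
- rewrite exprMn le_eqVlt; apply/orP; left; apply/eqP; ring.
- exact: ltW.
Qed.

End dyadic_potential.

(** * Integrals of directional derivatives *)

Section dominated.
Context {R : realType} d {T : measurableType d} (mu : {measure set T -> \bar R}).
Variables (D : set T) (mD : measurable D).
Implicit Types (f g : T -> R).

Lemma le_integrableR f g : measurable_fun D f ->
  mu.-integrable D (EFin \o g) -> (forall x, D x -> `|f x| <= g x) ->
  mu.-integrable D (EFin \o f).
Proof.
move=> mf ig fg; apply: (le_integrable mD) ig; first exact/measurable_EFinP.
by move=> x Dx /=; rewrite lee_fin; apply: le_trans (fg _ Dx) (ler_norm _).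
Qed.

Lemma dominated_cvgR (f_ : (T -> R)^nat) f g :
  (forall k, measurable_fun D (f_ k)) ->
  (forall x, D x -> f_ k x @[k --> \oo] --> f x) ->
  mu.-integrable D (EFin \o g) ->
  (forall k x, D x -> `|f_ k x| <= g x) ->
  (\int[mu]_(x in D) (f_ k x)%:E @[k --> \oo] --> \int[mu]_(x in D) (f x)%:E)%E.
Proof.
move=> mf cf ig fg.
apply: (@dominated_cvg _ _ _ mu D mD (fun k x => (f_ k x)%:E) _ (EFin \o g)) => //.
- by move=> k; exact/measurable_EFinP.
- by move=> x Dx; apply: cvg_EFin; [exact: nearW|exact: cf].
Qed.

End dominated.

Section directional_derivative.
Context {R : realType} {n : nat}.
Implicit Types (f : 'rV[R]_n -> R) (x v : 'rV[R]_n).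

(** The two difference quotients are the same function of [h], so the mean value theorem and the
    chain rule on the line transfer to directional derivatives. *)
Lemma is_derive_line f x v s df :
  is_derive (s *: v + x) v f df <-> is_derive s 1 (fun t : R => f (t *: v + x)) df.
Proof.
have E : (fun h : R => h^-1 *: ((f \o shift (s *: v + x)) (h *: v) - f (s *: v + x))) =
  (fun h : R => h^-1 *: (((fun t : R => f (t *: v + x)) \o shift s) (h *: (1:R)) -
    (fun t : R => f (t *: v + x)) s)).
  apply/funext => h /=; congr (_ *: (f _ - _)).
  by rewrite addrA -scalerDl [h *: 1]mulr1.
split=> -[D1 D2]; split.
- by rewrite /derivable -E.
- by rewrite /derive -E.
- by rewrite /derivable E.
- by rewrite /derive E.
Qed.

Lemma is_derive_line0 f x v df :
  is_derive x v f df <-> is_derive (0 : R) (1 : R) (fun t : R => f (t *: v + x)) df.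
Proof. by rewrite -is_derive_line scale0r add0r. Qed.

Lemma is_derive1_continuous (f : R -> R) (s df : R) :
  is_derive s 1 f df -> {for s, continuous f}.
Proof.
move=> H; apply: differentiable_continuous; apply/derivable1_diffP.
exact: (@ex_derive _ _ _ _ _ _ _ H).
Qed.

(** The mean value theorem on the segment from [0] to [h]; both signs of [h] have to be treated. *)
Lemma line_lipschitz f (df : R -> R) x v (M h : R) :
  (forall s, `|s| <= `|h| -> is_derive (s *: v + x) v f (df s)) ->
  (forall s, `|s| <= `|h| -> `|df s| <= M) ->
  `|f (h *: v + x) - f x| <= M * `|h|.
Proof.
move=> fd fM; pose g (t : R) : R := f (t *: v + x).
have gd (s : R) : `|s| <= `|h| -> is_derive s (1 : R) g (df s).
  by move=> sh; apply/is_derive_line; exact: fd.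
have -> : f x = g 0 by rewrite /g scale0r add0r.
rewrite -/(g h).
have M0 : 0 <= M by apply: le_trans (fM 0 _); rewrite ?normr0.
have [h0|h0|<-] := ltgtP 0 h; last by rewrite subrr !normr0 mulr0.
  have H s : s \in `[0, h] -> `|s| <= `|h|.
    by rewrite in_itv/= => /andP[s0 sh]; rewrite !ger0_norm// (ltW h0).
  have [||c ch ->] := @MVT_segment R g df 0 h (ltW h0).
  - by move=> s sh; apply: gd; apply: H; exact: subset_itv_oo_cc.
  - apply: continuous_in_subspaceT => s; rewrite inE/= => sh.
    by apply: is_derive1_continuous; apply: gd; exact: H.
  by rewrite subr0 normrM ler_wpM2r// fM// H.
have H s : s \in `[h, 0] -> `|s| <= `|h|.
  by rewrite in_itv/= => /andP[s0 sh]; rewrite !ler0_norm ?lerN2// (ltW h0).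
have [||c ch e] := @MVT_segment R g df h 0 (ltW h0).
- by move=> s sh; apply: gd; apply: H; exact: subset_itv_oo_cc.
- apply: continuous_in_subspaceT => s; rewrite inE/= => sh.
  by apply: is_derive1_continuous; apply: gd; exact: H.
by rewrite distrC e sub0r normrM normrN ler_wpM2r// fM// H.
Qed.

(** Sequential form of the derivative, suited to dominated convergence. *)
Lemma derive_seq f x v df (h : R^nat) : is_derive x v f df ->
  (forall k, h k != 0) -> h k @[k --> \oo] --> 0 ->
  (h k)^-1 * (f (h k *: v + x) - f x) @[k --> \oo] --> df.
Proof.
move=> [/cvg_ex[/= l fl] fdf] h0 hc.
have dl : df = l by rewrite -fdf; exact/cvg_lim.
rewrite dl; move/cvgr_dnbhsP : fl => /(_ h (conj h0 hc)).
by [].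
Qed.

End directional_derivative.

Section compact_support.
Context {R : realType} {n : nat}.
Implicit Types (f g : 'rV[R]_n -> R) (K : set 'rV[R]_n).

Lemma compact_support_bounded f K : compact K ->
  (forall x, K x -> {for x, continuous f}) ->
  exists2 M, 0 <= M & forall x, K x -> `|f x| <= M.
Proof.
move=> cK cf.
have : compact (f @` K).
  apply: continuous_compact => //; apply/continuous_in_subspaceT => x.
  by rewrite inE => /cf.
move=> /compact_bounded[M [_ MK]].
exists (`|M| + 1); first by rewrite addr_ge0.
move=> x Kx; apply: (MK (`|M| + 1)); last by exists x.
by rewrite (le_lt_trans (ler_norm _))// ltrDl.
Qed.

Lemma integrable_eball (M : R) (x : 'rV[R]_n) r : 0 < r ->
  (@leb R n).-integrable setT (EFin \o (fun y => M * \1_(eball x r) y)).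
Proof.
move=> r0; apply/integrableP; split.
  apply/measurable_EFinP; apply: measurable_funM => //.
  by apply: measurable_indic; exact: measurable_eball.
under eq_integral => y _ do rewrite /= normrM [X in _ * X]ger0_norm// EFinM.
rewrite ge0_integralZl_EFin//; last first.
  by apply/measurable_EFinP; apply: measurable_indic; exact: measurable_eball.
rewrite integral_indic//; last exact: measurable_eball.
rewrite setIT lte_mul_pinfty//.
by apply: le_lt_trans (leb_eball x r0) _; rewrite ltry.
Qed.

Lemma integrable_bounded_support f (M r : R) : 0 < r ->
  measurable_fun setT f -> (forall x, `|f x| <= M) ->
  (forall x, r <= enorm x -> f x = 0) ->
  (@leb R n).-integrable setT (EFin \o f).
Proof.
move=> r0 mf fM f0.
have M0 : 0 <= M := le_trans (normr_ge0 _) (fM 0).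
apply: (le_integrableR _ mf (@integrable_eball M 0 _ r0)) => //.
move=> x _; rewrite indicE; have [xr|xr] := ltP (enorm x) r.
  by rewrite mem_set ?mulr1// /eball/= subr0.
by rewrite f0// normr0 mulr_ge0.
Qed.

End compact_support.

(** * Vanishing integral of a compactly supported derivative *)

Section integral_partial.
Context {R : realType} {n : nat}.
Implicit Types (f g : 'rV[R]_n -> R) (K : set 'rV[R]_n).

Lemma is_derive_off_support f df K x v : closed K ->
  (forall y, ~ K y -> f y = 0) -> ~ K x -> is_derive x v f df -> df = 0.
Proof.
move=> cK f0 Kx [_ <-].
rewrite (@near_eq_derive _ _ _ _ (cst 0)) ?derive_cst//.
have : nbhs x (~` K) by apply: open_nbhs_nbhs; split => //; exact: closed_openC.
by apply: filterS => y /f0.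
Qed.

Lemma integral_is_derive0 f df (v : 'rV[R]_n) K : compact K ->
  (forall x, ~ K x -> f x = 0) -> continuous f ->
  (forall x, is_derive x v f (df x)) -> continuous df ->
  (@leb R n).-integrable setT (EFin \o df) /\
  (\int[@leb R n]_x (df x)%:E = 0)%E.
Proof.
move=> cK f0 cf fd cdf.
have clK : closed K by apply: compact_closed => //; exact: norm_hausdorff.
have df0 x : ~ K x -> df x = 0.
  by move=> Kx; exact: (is_derive_off_support clK f0 Kx (fd x)).
have [r r0 Kr] := compact_enorm cK.
have Kfar x : r <= enorm x -> ~ K x.
  by move=> rx /Kr; rewrite ltNge rx.
have glob g : (forall x, ~ K x -> g x = 0) -> continuous g ->
    exists2 M, 0 <= M & forall x, `|g x| <= M.
  move=> g0 cg; have [M M0 gM] := compact_support_bounded cK (fun x _ => cg x).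
  by exists M => // x; have [/gM//|/g0 ->] := pselect (K x); rewrite normr0.
have [M M0 dfM] := glob _ df0 cdf.
have [N N0 fN] := glob _ f0 cf.
have idf : (@leb R n).-integrable setT (EFin \o df).
  apply: (integrable_bounded_support r0 _ dfM) => [|x /Kfar/df0//].
  exact: continuous_measurable_rV.
split => //.
have if_ : (@leb R n).-integrable setT (EFin \o f).
  apply: (integrable_bounded_support r0 _ fN) => [|x /Kfar/f0//].
  exact: continuous_measurable_rV.
pose h : R^nat := harmonic.
have h0 k : 0 < h k by exact: harmonic_gt0.
pose F k x := (h k)^-1 * (f (h k *: v + x) - f x).
have vE k x : h k *: v + x = 1 *: x + h k *: v by rewrite scale1r addrC.
have mT k : measurable_fun setT (fun x => h k *: v + x).
  rewrite (_ : (fun x => _) = (fun x => 1 *: x + h k *: v)).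
    exact: measurable_affine_rV.
  by apply/funext => x; rewrite vE.
have mF k : measurable_fun setT (F k).
  apply: measurable_funM => //; apply: measurable_funB.
    apply: (measurableT_comp (continuous_measurable_rV cf)).
    exact: mT.
  exact: continuous_measurable_rV.
(* The mean value theorem bounds the quotients by the supremum of the derivative, independently of
   [k]. *)
have FM k x : `|F k x| <= M.
  rewrite normrM normfV (ger0_norm (ltW (h0 k))).
  rewrite mulrC ler_pdivrMr//.
  have := @line_lipschitz R n f (fun s => df (s *: v + x)) x v M (h k).
  rewrite (ger0_norm (ltW (h0 k))); apply => s _.
  exact: dfM.
have hle1 k : h k <= 1.
  by rewrite /h /harmonic/= invf_le1// ler1n.
(* Since [h k <= 1], a single ball, larger by [enorm v], contains the supports of all the difference
   quotients. *)
have F0 k x : r + enorm v <= enorm x -> F k x = 0.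
  move=> rx; rewrite /F f0 ?f0 ?subrr ?mulr0//.
    by apply: Kfar; apply: le_trans rx; rewrite lerDl enorm_ge0.
  apply: Kfar; move: rx; rewrite -lerBrDr => rx; apply: le_trans rx _.
  rewrite lerBlDr.
  have -> : enorm x = enorm ((h k *: v + x) - h k *: v).
    by rewrite addrAC subrr add0r.
  apply: le_trans (ler_enormD _ _) _; rewrite lerD2l enormN enormZ.
  by rewrite ger0_norm ?(ltW (h0 k))// ler_piMl ?enorm_ge0.
have r1 : 0 < r + enorm v by rewrite ltr_wpDr ?enorm_ge0.
(* The two terms of the quotient have equal integrals by translation invariance. *)
have intF k : (\int[@leb R n]_x (F k x)%:E = 0)%E.
  pose g x := f (h k *: v + x).
  have ig : (@leb R n).-integrable setT (EFin \o g).
    apply: (@integrable_bounded_support _ _ g N (r + enorm v)) => //.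
    - apply: (measurableT_comp (continuous_measurable_rV cf)).
      exact: mT.
    - move=> x; exact: fN.
    - move=> x rx; have := F0 k x rx; rewrite /F => /eqP.
      rewrite mulf_eq0 invr_eq0 gt_eqF//= subr_eq0 /g => /eqP ->.
      by apply/f0/Kfar; apply: le_trans rx; rewrite lerDl enorm_ge0.
  under eq_integral do rewrite EFinM EFinB.
  rewrite integralZl//; last exact: (integrableB measurableT ig if_).
  rewrite (integralB measurableT ig if_).
  have -> : (\int[@leb R n]_x (EFin \o g) x = \int[@leb R n]_x (EFin \o f) x)%E.
    have := integral_leb_affine (h k *: v) (@ltr01 R) if_.
    rewrite expr1n invr1 mul1e => <-.
    by apply: eq_integral => x _; rewrite /= /g vE.
  rewrite subee ?mule0//; exact: integrable_fin_num.
have := @dominated_cvgR _ _ _ (@leb R n) setT measurableT F df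
  (fun x => M * \1_(eball (0 : 'rV[R]_n) (r + enorm v)) x) mF.
have HF x : setT x -> F k x @[k --> \oo] --> df x.
  move=> _; apply: (derive_seq (fd x)) => [k|]; first by rewrite gt_eqF.
  exact: cvg_harmonic.
move=> /(_ HF (integrable_eball _ _ r1)) HH.
have {}HH := HH _.
apply/esym; rewrite -(@cvg_lim _ (@ereal_hausdorff R) _ _ _ _ _ (HH _)) => [|k x _].
  under eq_fun do rewrite intF.
  by apply/esym/cvg_lim => //; exact: cvg_cst.
rewrite indicE; have [xr|xr] := ltP (enorm x) (r + enorm v).
  by rewrite mem_set ?mulr1// /eball/= subr0.
by rewrite F0// normr0 mulr_ge0.
Qed.

End integral_partial.

(** * The Riesz kernel as a fundamental solution *)

Section real_valued_continuity.
Context {R : realType} {T : topologicalType}.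
Implicit Types (f g : T -> R) (x : T).

Lemma continuous_mul f g x : {for x, continuous f} -> {for x, continuous g} ->
  {for x, continuous (fun y => f y * g y)}.
Proof. by move=> cf cg; exact: (continuousM cf cg). Qed.

Lemma continuous_add f g x : {for x, continuous f} -> {for x, continuous g} ->
  {for x, continuous (fun y => f y + g y)}.
Proof. by move=> cf cg; exact: (@continuousD R R^o T f g x cf cg). Qed.

Lemma continuous_compR f (F : R -> R) x : {for x, continuous f} ->
  {for f x, continuous F} -> {for x, continuous (fun y => F (f y))}.
Proof. by move=> cf cF; exact: (continuous_comp cf cF). Qed.

Lemma continuous_cst (a : R) x : {for x, continuous (fun=> a)}.
Proof. exact: cvg_cst. Qed.

End real_valued_continuity.

(** * Derivatives of powers of the squared norm *)

Section kernel_derivatives.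
Context {R : realType} {n : nat}.
Implicit Types (f g : 'rV[R]_n -> R) (x v z : 'rV[R]_n) (e s : R).

Lemma is_derive_compl f (F : R -> R) x v (a b : R) :
  is_derive (f x) (1 : R) F a -> is_derive x v f b ->
  is_derive x v (fun y => F (f y)) (a * b).
Proof.
move=> FE /is_derive_line0 fE; apply/is_derive_line0.
apply: (@is_derive1_comp _ F (fun t => f (t *: v + x))) fE.
by rewrite scale0r add0r.
Qed.

Lemma is_derive_mul f g x v (a b : R) :
  is_derive x v f a -> is_derive x v g b ->
  is_derive x v (fun y => f y * g y) (a * g x + f x * b).
Proof.
move=> fa gb; apply: (is_derive_eq (is_deriveM fa gb)).
by rewrite addrC; congr (_ + _); exact: mulrC.
Qed.

(** Along a line, the squared norm and the coordinates are polynomials of degree at most 2, so their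
    derivatives are read off from the linear coefficient. *)
Lemma is_derive_quadratic (a b c : R) :
  is_derive (0 : R) (1 : R) (fun t : R => a + b * t + c * t ^+ 2) b.
Proof.
have hi := is_derive_id (0 : R) (1 : R).
have hb := @is_deriveZ R R^o R^o _ b _ _ _ hi.
have hc := @is_deriveZ R R^o R^o _ c _ _ _ (@is_deriveX R R^o id 2 _ _ _ hi).
have h := @is_deriveD R R^o R^o _ _ _ _ _ _
  (@is_deriveD R R^o R^o _ _ _ _ _ _ (is_derive_cst (a : R^o) (0 : R^o) (1 : R^o)) hb) hc.
apply: (is_derive_eq h).
by rewrite add0r expr1 mulr0 scale0r scaler0 addr0; exact: mulr1.
Qed.

Lemma dotv_line t v x :
  dotv (t *: v + x) (t *: v + x) = dotv x x + 2 * dotv v x * t + dotv v v * t ^+ 2.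
Proof.
rewrite /dotv mulr_sumr !mulr_suml -!big_split/=; apply: eq_bigr => i _.
rewrite !mxE; ring.
Qed.

Lemma is_derive_dotv x v : is_derive x v (fun z => dotv z z) (2 * dotv v x).
Proof.
apply/is_derive_line0; under eq_fun do rewrite dotv_line.
exact: is_derive_quadratic.
Qed.

Lemma is_derive_coord x v i : is_derive x v (fun z => z ord0 i) (v ord0 i).
Proof.
apply/is_derive_line0.
rewrite (_ : (fun t => _) = fun t : R => x ord0 i + v ord0 i * t + 0 * t ^+ 2).
  exact: is_derive_quadratic.
by apply/funext => t; rewrite !mxE; ring.
Qed.

Lemma dotv_delta x i : dotv (delta_mx ord0 i) x = x ord0 i.
Proof.
rewrite /dotv (bigD1 i)//= big1 => [|j ji]; rewrite mxE eqxx/=.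
  by rewrite eqxx mul1r addr0.
by rewrite (negbTE ji) mul0r.
Qed.

(** The hypothesis allows [e > 0] everywhere and [e = 0] away from the origin: the same formula
    differentiates the regularized kernels and the Newtonian kernel. *)
Lemma is_derive_qpow e s x v : 0 < dotv x x + e ->
  is_derive x v (fun z => (dotv z z + e) `^ s)
    (s * (dotv x x + e) `^ (s - 1) * (2 * dotv v x)).
Proof.
move=> xe.
apply: (@is_derive_compl (fun z => dotv z z + e) (fun t => t `^ s)).
  exact: is_derive1_powR.
apply: (is_derive_eq (@is_deriveD _ _ _ (fun z => dotv z z) (cst e) x v _ _
  (is_derive_dotv x v) (is_derive_cst _ _ _))).
by rewrite addr0.
Qed.

Lemma dotv_continuous : continuous (fun x : 'rV[R]_n => dotv x x).
Proof.
rewrite (_ : (fun x => _) = (fun x => enorm x * enorm x)).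
  by move=> x; apply: continuous_mul; exact: enorm_continuous.
by apply/funext => x; rewrite -sqr_enorm expr2.
Qed.

Lemma qpow_continuous e s : 0 < e ->
  continuous (fun x : 'rV[R]_n => (dotv x x + e) `^ s).
Proof.
move=> e0 x.
have xe : 0 < dotv x x + e by rewrite ltr_wpDl ?dotv_ge0.
apply: (@continuous_compR _ _ (fun x => dotv x x + e) (fun t => t `^ s)).
  by apply: continuous_add; [exact: dotv_continuous|exact: continuous_cst].
apply: is_derive1_continuous; exact: is_derive1_powR.
Qed.

Lemma ler_powR_neg (a b s : R) : 0 < a -> a <= b -> s <= 0 -> b `^ s <= a `^ s.
Proof.
move=> a0 ab s0; rewrite -(opprK s) powRN (powRN a) lef_pV2 ?posrE ?powR_gt0//.
  apply: ge0_ler_powR; rewrite ?oppr_ge0 ?nnegrE//; first exact: ltW.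
  exact: le_trans (ltW a0) ab.
exact: lt_le_trans ab.
Qed.

Lemma dotv_powR x s : dotv x x `^ (s / 2) = enorm x `^ s.
Proof. by rewrite mulrC powRrM powR12_sqrt// dotv_ge0. Qed.

End kernel_derivatives.

(** * Regularized Riesz kernels *)

Section regularized_kernel.
Context {R : realType} {n : nat}.
Implicit Types (x y z : 'rV[R]_n) (e : R) (i : 'I_n).

(* At [e = 0] this is [z_i / |z|^n], with value 0 at the origin. *)
Definition riesz e i z : R := z ord0 i * (dotv z z + e) `^ (- n%:R / 2).

Lemma riesz0E i z : riesz 0 i z = z ord0 i * enorm z `^ (- n%:R).
Proof. by rewrite /riesz addr0 dotv_powR. Qed.

(** The coordinate is at most [|z|], and adding [e] to the base of a nonpositive power only
    decreases it. The bound is uniform in [e], as the limit [e -> 0] requires. *)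
Lemma riesz_bound e i z : 0 <= e -> `|riesz e i z| <= enorm z `^ (1 - n%:R).
Proof.
move=> e0; have [->|z0] := eqVneq z 0.
  by rewrite /riesz mxE mul0r normr0 powR_ge0.
have z1 := enorm_gt0 z0.
rewrite normrM (ger0_norm (powR_ge0 _ _)).
rewrite powRD; last by rewrite (gt_eqF z1) implybT.
rewrite powRr1 ?enorm_ge0// -dotv_powR.
apply: ler_pM => //; first exact: powR_ge0.
  exact: coord_le_enorm.
apply: ler_powR_neg; first by rewrite -sqr_enorm exprn_gt0.
  by rewrite lerDl.
by rewrite mulNr oppr_le0 divr_ge0.
Qed.

Lemma riesz_continuous e i : 0 < e -> continuous (riesz e i).
Proof.
move=> e0 z; apply: (@continuous_mul _ _ (fun w : 'rV[R]_n => w ord0 i)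
  (fun w => (dotv w w + _) `^ _)); first exact: coord_continuous.
exact: qpow_continuous.
Qed.

Lemma riesz0_continuous i z : z != 0 -> {for z, continuous (riesz 0 i)}.
Proof.
move=> z0; rewrite /riesz; apply: (@continuous_mul _ _ (fun w : 'rV[R]_n => w ord0 i)
  (fun w => (dotv w w + _) `^ _)); first exact: coord_continuous.
apply: (@continuous_compR _ _ (fun x => dotv x x + 0) (fun t => t `^ _)).
  by apply: continuous_add; [exact: dotv_continuous|exact: continuous_cst].
apply: is_derive1_continuous; apply: is_derive1_powR.
by rewrite addr0 -sqr_enorm exprn_gt0// enorm_gt0.
Qed.

Lemma measurable_riesz e i : measurable_fun setT (riesz e i).
Proof.
apply: measurable_funM.
  apply: continuous_measurable_rV; exact: coord_continuous.
apply: (measurableT_comp (measurable_powR _)).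
apply: measurable_funD => //.
by apply: continuous_measurable_rV; exact: dotv_continuous.
Qed.

Lemma is_derive_riesz e i z : 0 < e ->
  is_derive z (delta_mx ord0 i) (riesz e i)
    ((dotv z z + e) `^ (- n%:R / 2) -
     n%:R * z ord0 i ^+ 2 * (dotv z z + e) `^ (- n%:R / 2 - 1)).
Proof.
move=> e0; have ze : 0 < dotv z z + e by rewrite ltr_wpDl ?dotv_ge0.
apply: (is_derive_eq (is_derive_mul (is_derive_coord z (delta_mx ord0 i) i)
  (is_derive_qpow (- n%:R / 2) (delta_mx ord0 i) ze))).
rewrite dotv_delta mxE !eqxx/= mul1r; congr (_ + _); by field.
Qed.

(** With [w = |z|^2 + e], the sum is [n w^(-n/2-1) (w - |z|^2)], and only [e] survives in the
    bracket. *)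
Lemma riesz_divergence e z : 0 < e ->
  \sum_i ((dotv z z + e) `^ (- n%:R / 2) -
     n%:R * z ord0 i ^+ 2 * (dotv z z + e) `^ (- n%:R / 2 - 1)) =
  n%:R * e * (dotv z z + e) `^ (- n%:R / 2 - 1).
Proof.
move=> e0; have ze : 0 < dotv z z + e by rewrite ltr_wpDl ?dotv_ge0.
rewrite sumrB sumr_const card_ord -mulr_suml -mulr_sumr.
rewrite (_ : \sum_i z ord0 i ^+ 2 = dotv z z); last first.
  by apply: eq_bigr => i _; rewrite expr2.
set w := dotv z z + e; rewrite -[X in X - _]mulr_natl.
have -> : w `^ (- n%:R / 2) = w * w `^ (- n%:R / 2 - 1).
  rewrite powRB; last by rewrite (gt_eqF ze) implybT.
  by rewrite powRr1 ?(ltW ze)// mulrCA mulfV ?mulr1// gt_eqF.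
by rewrite /w; ring.
Qed.

End regularized_kernel.

(** * Pairing the regularized kernels with compactly supported functions *)

Section C1_compact_support.
Context {R : realType} {n : nat}.

(** The partial derivatives are a parameter, so that for translates and products they can be given
    by explicit formulas. [K] is any compact set off which [phi] vanishes. *)
Definition C1_supported (K : set 'rV[R]_n) (phi : 'rV[R]_n -> R)
    (dphi : 'I_n -> 'rV[R]_n -> R) :=
  [/\ compact K, forall x, ~ K x -> phi x = 0, continuous phi,
    forall i x, is_derive x (delta_mx ord0 i) phi (dphi i x) &
    forall i, continuous (dphi i)].

Variables (K : set 'rV[R]_n) (phi : 'rV[R]_n -> R) (dphi : 'I_n -> 'rV[R]_n -> R).
Hypothesis C1phi : C1_supported K phi dphi.

Lemma C1_supported_closed : closed K.
Proof.
by case: C1phi => cK _ _ _ _; apply: compact_closed => //; exact: norm_hausdorff.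
Qed.

Lemma C1_supported_partial0 i x : ~ K x -> dphi i x = 0.
Proof.
case: C1phi => cK phi0 cphi phiE _ Kx.
exact: (is_derive_off_support C1_supported_closed phi0 Kx (phiE i x)).
Qed.

Lemma C1_supported_bound : exists M r : R, [/\ 0 <= M, 0 < r,
  forall x, r <= enorm x -> ~ K x, forall x, `|phi x| <= M &
  forall i x, `|dphi i x| <= M].
Proof.
case: (C1phi) => cK phi0 cphi phiE cdphi.
have [r r0 Kr] := compact_enorm cK.
have [M M0 phiM] := compact_support_bounded cK (fun x _ => cphi x).
pose P i (N : R) := 0 <= N /\ forall x, K x -> `|dphi i x| <= N.
have exN i : exists N, P i N.
  by have [N N0 dN] := compact_support_bounded cK (fun x _ => cdphi i x); exists N.
have [N NP] := choice exN.
have S0 : 0 <= \sum_i N i by apply: sumr_ge0 => i _; case: (NP i).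
exists (M + \sum_i N i), r; split => //.
- by rewrite addr_ge0.
- by move=> x rx /Kr; rewrite ltNge rx.
- move=> x; have [/phiM Kx|/phi0 ->] := pselect (K x).
    by rewrite (le_trans Kx)// lerDl.
  by rewrite normr0 addr_ge0.
- move=> i x; have [Kx|/C1_supported_partial0 ->] := pselect (K x); last first.
    by rewrite normr0 addr_ge0.
  apply: le_trans (proj2 (NP i) x Kx) _.
  apply: ler_wpDl => //; rewrite (bigD1 i)//= lerDl.
  by apply: sumr_ge0 => j _; case: (NP j).
Qed.

Lemma C1_supported_integrable (g : 'rV[R]_n -> R) : continuous g ->
  (forall x, ~ K x -> g x = 0) -> (@leb R n).-integrable setT (EFin \o g).
Proof.
case: (C1phi) => cK _ _ _ _ cg g0.
have [M M0 gM] := compact_support_bounded cK (fun x _ => cg x).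
have [r r0 Kr] := compact_enorm cK.
apply: (@integrable_bounded_support _ _ g M r) => //.
- exact: continuous_measurable_rV.
- move=> x; have [/gM//|/g0 ->] := pselect (K x).
  by rewrite normr0.
- by move=> x rx; apply: g0 => /Kr; rewrite ltNge rx.
Qed.

(** [df i] is the [i]-th derivative of [riesz e i * phi] and has integral 0; summing over [i] leaves
    the divergence of the kernel times [phi]. *)
Lemma regularized_distribution (e : R) : 0 < e ->
  (\int[@leb R n]_x (\sum_i riesz e i x * dphi i x)%:E =
   - \int[@leb R n]_x (n%:R * e * (dotv x x + e) `^ (- n%:R / 2 - 1) * phi x)%:E)%E.
Proof.
move=> e0; case: (C1phi) => cK phi0 cphi phiE cdphi.
pose A i (z : 'rV[R]_n) := (dotv z z + e) `^ (- n%:R / 2) -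
     n%:R * z ord0 i ^+ 2 * (dotv z z + e) `^ (- n%:R / 2 - 1).
pose B (z : 'rV[R]_n) := n%:R * e * (dotv z z + e) `^ (- n%:R / 2 - 1).
have cq s : continuous (fun x : 'rV[R]_n => (dotv x x + e) `^ s).
  exact: qpow_continuous.
have cA i : continuous (A i).
  move=> x; apply: (@continuous_add _ _ (fun z => (dotv z z + e) `^ (- n%:R / 2))
    (fun z => - (n%:R * z ord0 i ^+ 2 * (dotv z z + e) `^ (- n%:R / 2 - 1)))).
    exact: cq.
  rewrite (_ : (fun z => _) = (fun z : 'rV[R]_n => (- n%:R) * (z ord0 i * z ord0 i) *
    (dotv z z + e) `^ (- n%:R / 2 - 1))); last first.
    by apply/funext => z; rewrite expr2 !mulNr.
  apply: continuous_mul; last exact: cq.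
  apply: continuous_mul; first exact: continuous_cst.
  by apply: continuous_mul; exact: coord_continuous.
have cB : continuous B.
  move=> x; apply: (@continuous_mul _ _ (fun=> n%:R * e)
    (fun z : 'rV[R]_n => (dotv z z + e) `^ (- n%:R / 2 - 1))); last exact: cq.
  exact: continuous_cst.
pose df i x := A i x * phi x + riesz e i x * dphi i x.
have Kdf i : (@leb R n).-integrable setT (EFin \o df i) /\
    (\int[@leb R n]_x (df i x)%:E = 0)%E.
  apply: (@integral_is_derive0 _ _ (fun x => riesz e i x * phi x) (df i)
    (delta_mx ord0 i) K) => //.
  - by move=> x Kx; rewrite phi0 ?mulr0.
  - move=> x; apply: continuous_mul; [exact: riesz_continuous|exact: cphi].
  - move=> x; apply: is_derive_mul; exact: is_derive_riesz.
  - move=> x; apply: (@continuous_add _ _ (fun x => A i x * phi x)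
      (fun x => riesz e i x * dphi i x)).
      by apply: continuous_mul; [exact: cA|exact: cphi].
    by apply: continuous_mul; [exact: riesz_continuous|exact: cdphi].
have E x : (\sum_i riesz e i x * dphi i x)%:E =
    (\sum_i (df i x)%:E + (- (B x * phi x))%:E)%E.
  rewrite sumEFin -EFinD; congr EFin; rewrite /df big_split/= -mulr_suml.
  by rewrite riesz_divergence// -/(B x) addrAC subrr add0r.
under eq_integral do rewrite E.
have iB : (@leb R n).-integrable setT (EFin \o (fun x => B x * phi x)).
  apply: C1_supported_integrable.
    by move=> x; apply: continuous_mul; [exact: cB|exact: cphi].
  by move=> x Kx; rewrite phi0 ?mulr0.
have iNB : (@leb R n).-integrable setT (fun x => (- (B x * phi x))%:E).
  exact: (integrableN iB).
have idf : (@leb R n).-integrable setT (fun x => \sum_i (df i x)%:E)%E.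
  by apply: integrable_sum => // i _; exact: (Kdf i).1.
rewrite (integralD measurableT idf iNB).
rewrite (_ : (\int[@leb R n]_x \sum_i (df i x)%:E)%E = 0%E) ?add0e; last first.
  rewrite integral_sum//; last by move=> i; exact: (Kdf i).1.
  by rewrite big1// => i _; exact: (Kdf i).2.
under eq_integral do rewrite EFinN.
rewrite integralN//.
by rewrite fin_num_adde_defl// fin_numN integrable_neg_fin_num.
Qed.

End C1_compact_support.

Lemma cvg_sumR {R : realType} (I T : Type) (F : set_system T) (FF : Filter F)
    (r : seq I) (f : I -> T -> R) (l : I -> R) :
  (forall i, f i t @[t --> F] --> l i) ->
  \sum_(i <- r) f i t @[t --> F] --> \sum_(i <- r) l i.
Proof.
by move=> fl; apply: cvg_big => //; exact: add_continuous.
Qed.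

(** * The limit of the regularized kernels *)

Section kernel_distribution.
Context {R : realType} {n : nat}.
Hypothesis n2 : (1 < n)%N.
Implicit Types (x y z : 'rV[R]_n).

Lemma measurable_scale_rV (a : R) :
  measurable_fun setT (fun z : 'rV[R]_n => a *: z).
Proof.
rewrite (_ : (fun z => _) = (fun z => a *: z + 0)); first exact: measurable_affine_rV.
by apply/funext => z; rewrite addr0.
Qed.

Lemma leb_eball_powR x (r : R) : 0 < r ->
  (@leb R n (eball x r) <= (2 ^+ n * r `^ n%:R)%:E)%E.
Proof.
move=> r0; apply: le_trans (leb_eball x r0) _.
by rewrite lee_fin exprMn powR_mulrn// ltW.
Qed.

(** Lebesgue measure of balls grows like [r^n], so [dyadic_inner] applies with [s = n] and
    [t = n - 1]; positivity of [t] is where [1 < n] enters. *)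
Lemma integrable_riesz_majorant (r M : R) : 0 < r -> 0 <= M ->
  (@leb R n).-integrable setT
    (EFin \o (fun x => M * (enorm x `^ (1 - n%:R) * \1_(eball (0 : 'rV[R]_n) r) x))).
Proof.
move=> r0 M0; apply: (@integrableZl _ _ _ _ _ measurableT M (EFin \o _)).
have -> : EFin \o (fun x => enorm x `^ (1 - n%:R) * \1_(eball (0 : 'rV[R]_n) r) x) =
   ((EFin \o (fun x => enorm x `^ (1 - n%:R))) \_ (eball (0 : 'rV[R]_n) r)).
  by rewrite epatch_indic; apply/funext => x /=; rewrite EFinM.
apply/(integrable_mkcond _ (measurable_eball _ _)).
have Ee x : enorm x `^ (1 - n%:R) = enorm (0 - x) `^ (- (n%:R - 1)).
  by rewrite sub0r enormN opprB.
apply/integrableP; split.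
  apply/measurable_EFinP; under eq_fun do rewrite Ee.
  exact: measurable_enorm_sub.
have [||K K0 H] := @dyadic_inner R n (2 ^+ n) n%:R (n%:R - 1) (exprn_ge0 n (ler0n R 2)).
- by rewrite ltrBlDr ltrDl.
- by rewrite subr_gt0 ltr1n.
under eq_integral => x _ do rewrite /= ger0_norm ?powR_ge0// Ee.
apply: le_lt_trans (H _ 0 r (eball 0 r) r0 _ _ _) _ => //.
- by move=> s s0; exact: leb_eball_powR.
- exact: measurable_eball.
- by move=> y; rewrite /eball/= subr0 sub0r enormN.
- exact: ltry.
Qed.

(* The divergence of [riesz 1]; its rescalings are the divergences of the other
   [riesz e] and, up to the total mass [riesz_const], an approximate identity. *)
Definition bump z : R := n%:R * (dotv z z + 1) `^ (- n%:R / 2 - 1).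

Lemma bump_ge0 z : 0 <= bump z.
Proof. by rewrite mulr_ge0// powR_ge0. Qed.

Lemma bump_continuous : continuous bump.
Proof.
move=> z; apply: (@continuous_mul _ _ (fun=> n%:R)
    (fun z : 'rV[R]_n => (dotv z z + 1) `^ (- n%:R / 2 - 1))).
  exact: continuous_cst.
exact: qpow_continuous.
Qed.

(** The majorant is [n] on the unit ball and [n |z|^-(n+2)] outside; [dyadic_outer] with [s = n],
    [t = n + 2] handles the tail. *)
Lemma integrable_bump : (@leb R n).-integrable setT (EFin \o bump).
Proof.
pose g1 z : R := n%:R * \1_(eball (0 : 'rV[R]_n) 1) z.
pose g2 z : R := n%:R * (enorm z `^ (- (n%:R + 2)) * \1_(~` eball (0 : 'rV[R]_n) 1) z).
pose g z : R := g1 z + g2 z.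
have ig : (@leb R n).-integrable setT (EFin \o g).
  rewrite (_ : EFin \o g = ((EFin \o g1) \+ (EFin \o g2))%E) //.
  apply: integrableD => //; first exact: integrable_eball.
  apply: (@integrableZl _ _ _ _ _ measurableT (n%:R) (EFin \o _)).
  have mC : measurable (~` eball (0 : 'rV[R]_n) 1).
    by apply: measurableC; exact: measurable_eball.
  have -> : EFin \o (fun x => enorm x `^ (- (n%:R + 2)) *
        \1_(~` eball (0 : 'rV[R]_n) 1) x) =
     ((EFin \o (fun x => enorm x `^ (- (n%:R + 2)))) \_ (~` eball (0 : 'rV[R]_n) 1)).
    by rewrite epatch_indic; apply/funext => x /=; rewrite EFinM.
  apply/(integrable_mkcond _ mC).
  have Ee x : enorm x `^ (- (n%:R + 2)) = enorm (0 - x) `^ (- (n%:R + 2)).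
    by rewrite sub0r enormN.
  apply/integrableP; split.
    apply/measurable_EFinP; under eq_fun do rewrite Ee.
    exact: measurable_enorm_sub.
  have [||K K0 H] := @dyadic_outer R n (2 ^+ n) n%:R (n%:R + 2) (exprn_ge0 n (ler0n R 2)).
  - by rewrite ltrDl.
  - by rewrite addr_ge0.
  under eq_integral => x _ do rewrite /= ger0_norm ?powR_ge0// Ee.
  apply: le_lt_trans (H _ 0 1 (~` eball 0 1) ltr01 _ _ _) _ => //.
  - by move=> s s1; apply: leb_eball_powR; exact: lt_le_trans s1.
  - by move=> y /negP; rewrite /eball/= subr0 sub0r enormN -leNgt.
  - exact: ltry.
apply: (le_integrableR measurableT _ ig).
  by apply: continuous_measurable_rV; exact: bump_continuous.
move=> z _; rewrite ger0_norm ?bump_ge0// /g /g1 /g2 !indicE in_setC.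
have e1 : (- n%:R / 2 - 1 : R) <= 0.
  by rewrite mulNr -opprD oppr_le0 addr_ge0// divr_ge0.
have [z1|z1] := boolP (z \in eball 0 1); rewrite /= ?mulr1 ?mulr0 ?addr0 ?add0r.
  rewrite /bump ler_piMr//.
  have q1 : 1 <= dotv z z + 1 by rewrite lerDr dotv_ge0.
  by have := ler_powR_neg ltr01 q1 e1; rewrite powR1.
rewrite /bump ler_wpM2l//.
have z1' : 1 <= enorm z.
  by move: z1; rewrite notin_setE /eball/= subr0 => /negP; rewrite -leNgt.
have -> : - (n%:R + 2) = 2 * (- n%:R / 2 - 1) :> R by field.
rewrite powRrM powR_mulrn ?enorm_ge0// sqr_enorm.
apply: ler_powR_neg => //; last by rewrite lerDl.
by rewrite -sqr_enorm exprn_gt0// (lt_le_trans _ z1').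
Qed.

(** Classically the area of the unit sphere, the flux of [z / |z|^n] through it; the value is left
    implicit. *)
Definition riesz_const : R := \int[@leb R n]_z bump z.

Lemma riesz_const_ge0 : 0 <= riesz_const.
Proof. by apply: Rintegral_ge0 => // z _; exact: bump_ge0. Qed.

Lemma EFin_riesz_const : (riesz_const%:E = \int[@leb R n]_z (bump z)%:E)%E.
Proof.
rewrite /riesz_const fineK//; apply: integrable_fin_num => //.
exact: integrable_bump.
Qed.

(** Substitute [x = h z]. The regularization parameter is [h^2], so that [h] is a length; the
    Jacobian [h^n] cancels the factor [h^2 (h^2)^(-n/2-1) = h^-n]. *)
Lemma rescaled_bump (h : R) (K : set 'rV[R]_n) phi dphi : 0 < h ->
  C1_supported K phi dphi ->
  (\int[@leb R n]_x (n%:R * h ^+ 2 * (dotv x x + h ^+ 2) `^ (- n%:R / 2 - 1) * phi x)%:E =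
   \int[@leb R n]_z (bump z * phi (h *: z))%:E)%E.
Proof.
move=> h0 C1; pose f x := n%:R * h ^+ 2 * (dotv x x + h ^+ 2) `^ (- n%:R / 2 - 1) * phi x.
have h20 : 0 < h ^+ 2 by rewrite exprn_gt0.
have fi : (@leb R n).-integrable setT (EFin \o f).
  apply: (C1_supported_integrable C1).
    case: C1 => _ _ cphi _ _.
    move=> x; apply: (@continuous_mul _ _
      (fun x => n%:R * h ^+ 2 * (dotv x x + h ^+ 2) `^ (- n%:R / 2 - 1)));
      last exact: cphi.
    apply: (@continuous_mul _ _ (fun=> n%:R * h ^+ 2)
      (fun x : 'rV[R]_n => (dotv x x + h ^+ 2) `^ (- n%:R / 2 - 1))).
      exact: continuous_cst.
    exact: qpow_continuous.
  by case: C1 => _ phi0 _ _ _ x /phi0; rewrite /f => ->; rewrite mulr0.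
have := integral_leb_affine 0 h0 fi.
have E z : (EFin \o f) (h *: z + 0) = ((h ^- n)%:E * (bump z * phi (h *: z))%:E)%E.
  rewrite addr0 -EFinM /= /f /bump; congr EFin.
  have -> : dotv (h *: z) (h *: z) + h ^+ 2 = h ^+ 2 * (dotv z z + 1).
    by rewrite -!sqr_enorm enormZ exprMn real_normK ?num_real//; ring.
  rewrite powRM ?(ltW h20) ?addr_ge0 ?dotv_ge0//.
  have -> : (h ^+ 2) `^ (- n%:R / 2 - 1) = h ^- n * h ^- 2.
    rewrite -powR_mulrn ?(ltW h0)// -powRrM.
    have -> : 2 * (- n%:R / 2 - 1) = - (n + 2)%:R :> R by rewrite natrD; field.
    by rewrite powR_invn ?(ltW h0)// exprD invfM powR_mulrn // ltW.
  by field; rewrite expf_eq0 (gt_eqF h0) andbF.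
under eq_integral do rewrite E.
have ib : (@leb R n).-integrable setT (fun z => (bump z * phi (h *: z))%:E).
  have [M [r [M0 r0 Kr phiM _]]] := C1_supported_bound C1.
  apply: (@le_integrable _ _ _ (@leb R n) setT measurableT _
     (fun z => M%:E * (EFin \o bump) z)%E).
  - apply/measurable_EFinP; apply: measurable_funM.
      by apply: continuous_measurable_rV; exact: bump_continuous.
    case: C1 => _ _ cphi _ _.
    apply: (measurableT_comp (continuous_measurable_rV cphi)).
    exact: measurable_scale_rV.
  - move=> z _; rewrite -EFinM/= !lee_fin !normrM mulrC ler_wpM2r//.
    by rewrite (le_trans (phiM _))// ler_norm.
  - by apply: integrableZl => //; exact: integrable_bump.
rewrite integralZl//.
have hn0 : h ^- n != 0 by rewrite invr_eq0 expf_neq0// gt_eqF.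
by move/(congr1 (fun t => (h ^+ n)%:E * t)%E); rewrite !muleA -!EFinM mulfV
  ?expf_neq0 ?gt_eqF// !mul1e.
Qed.

Lemma measurable_riesz_pairing (e : R) (K : set 'rV[R]_n) phi dphi :
  C1_supported K phi dphi ->
  measurable_fun setT (fun x => \sum_i riesz e i x * dphi i x).
Proof.
move=> [_ _ _ _ cdphi]; apply: measurable_sum => i; apply: measurable_funM.
  exact: measurable_riesz.
by apply: continuous_measurable_rV; exact: cdphi.
Qed.

(** The right-hand side is free of [e]: it dominates all regularized pairings as well as the limit
    [e = 0]. *)
Lemma riesz_pairing_le (K : set 'rV[R]_n) phi dphi (e M r : R) x :
  C1_supported K phi dphi -> 0 <= e -> 0 <= M ->
  (forall x, r <= enorm x -> ~ K x) -> (forall i x, `|dphi i x| <= M) ->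
  `|\sum_i riesz e i x * dphi i x| <=
    n%:R * M * (enorm x `^ (1 - n%:R) * \1_(eball (0 : 'rV[R]_n) r) x).
Proof.
move=> C1 e0 M0 Kr dphiM.
rewrite indicE; have [xr|xr] := ltP (enorm x) r; last first.
  rewrite big1 ?normr0; last first.
    by move=> i _; rewrite (C1_supported_partial0 C1) ?mulr0//; exact: Kr.
  by rewrite !mulr_ge0// powR_ge0.
rewrite mem_set /eball/= ?subr0// mulr1.
apply: le_trans (ler_norm_sum _ _ _) _.
rewrite (_ : n%:R * M * _ = \sum_(i < n) (M * enorm x `^ (1 - n%:R))); last first.
  by rewrite sumr_const card_ord -mulrA mulr_natl.
by apply: ler_sum => i _; rewrite normrM mulrC ler_pM// riesz_bound.
Qed.

Lemma integrable_riesz_pairing (K : set 'rV[R]_n) phi dphi (e : R) :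
  C1_supported K phi dphi -> 0 <= e ->
  (@leb R n).-integrable setT (EFin \o (fun x => \sum_i riesz e i x * dphi i x)).
Proof.
move=> C1 e0; have [M [r [M0 r0 Kr phiM dphiM]]] := C1_supported_bound C1.
have nM0 : 0 <= n%:R * M by rewrite mulr_ge0.
apply: (le_integrableR measurableT _ (integrable_riesz_majorant r0 nM0)).
  exact: measurable_riesz_pairing C1.
by move=> x _; exact: (riesz_pairing_le x C1 e0 M0 Kr dphiM).
Qed.

Lemma C1_supported_translate (K : set 'rV[R]_n) phi dphi y :
  C1_supported K phi dphi ->
  C1_supported [set x - y | x in K] (fun x => phi (x + y)) (fun i x => dphi i (x + y)).
Proof.
move=> [cK phi0 cphi phiE cdphi].
have ct w : continuous (fun x : 'rV[R]_n => x + w).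
  rewrite (_ : (fun x => _) = (fun x => 1 *: x + w)); first exact: affine_continuous.
  by apply/funext => x; rewrite scale1r.
split.
- by apply: continuous_compact => //; apply: continuous_subspaceT; exact: ct.
- by move=> x Kx; apply: phi0 => Kxy; apply: Kx; exists (x + y) => //; rewrite addrK.
- by move=> x; apply: continuous_comp; [exact: ct|exact: cphi].
- move=> i x; apply/is_derive_line0.
  under eq_fun do rewrite -addrA.
  by apply/is_derive_line0.
- by move=> i x; apply: continuous_comp; [exact: ct|exact: cdphi].
Qed.

(** Let [e = h_k^2] tend to 0 in [regularized_distribution]: the left side is dominated by the Riesz
    majorant and, after rescaling, the right side by [M * bump], with [phi (h_k z)] tending to
    [phi 0]. *)
Lemma kernel_distribution0 (K : set 'rV[R]_n) phi dphi : C1_supported K phi dphi ->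
  (\int[@leb R n]_x (\sum_i riesz 0 i x * dphi i x)%:E = (- (riesz_const * phi 0))%:E)%E.
Proof.
move=> C1; have [M [r [M0 r0 Kr phiM dphiM]]] := C1_supported_bound C1.
case: (C1) => cK phi0 cphi phiE cdphi.
pose h : R^nat := harmonic.
have h0 k : 0 < h k by exact: harmonic_gt0.
have hc : h k @[k --> \oo] --> 0 by exact: cvg_harmonic.
pose F k x := \sum_i riesz (h k ^+ 2) i x * dphi i x.
have nM0 : 0 <= n%:R * M by rewrite mulr_ge0.
have cvL : (\int[@leb R n]_x (F k x)%:E @[k --> \oo] -->
    \int[@leb R n]_x (\sum_i riesz 0 i x * dphi i x)%:E)%E.
  apply: (@dominated_cvgR _ _ _ (@leb R n) setT measurableT F _ _ _ _
    (@integrable_riesz_majorant r (n%:R * M) r0 nM0)).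
  - by move=> k; exact: (measurable_riesz_pairing _ C1).
  - move=> x _; rewrite /F.
    apply: (@cvg_sumR _ _ _ _ _ _ (fun i k => riesz (h k ^+ 2) i x * dphi i x)
      (fun i => riesz 0 i x * dphi i x)) => i.
    apply: cvgM; last exact: cvg_cst.
    (* At the origin the coordinate factor makes every term 0, so convergence holds at every
       point. *)
    have [->|x0] := eqVneq x 0.
      by rewrite /riesz mxE; under eq_fun do rewrite mul0r; rewrite mul0r; exact: cvg_cst.
    apply: cvgM; first exact: cvg_cst.
    have q0 : 0 < dotv x x by rewrite -sqr_enorm exprn_gt0// enorm_gt0.
    have hh : dotv x x + h k ^+ 2 @[k --> \oo] --> dotv x x + 0.
      apply: cvgD; first exact: cvg_cst.
      rewrite -(mulr0 (0 : R)); under eq_fun do rewrite expr2.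
      by apply: cvgM.
    have cp : {for dotv x x + 0, continuous (fun t : R => t `^ (- n%:R / 2))}.
      by apply: is_derive1_continuous; apply: is_derive1_powR; rewrite addr0.
    exact: (cvg_comp _ _ hh cp).
  - by move=> k x _; exact: (riesz_pairing_le x C1 (sqr_ge0 (h k)) M0 Kr dphiM).
have cvR : (\int[@leb R n]_z (bump z * phi (h k *: z))%:E @[k --> \oo] -->
    \int[@leb R n]_z (bump z * phi 0)%:E)%E.
  apply: (@dominated_cvgR _ _ _ (@leb R n) setT measurableT
     (fun k z => bump z * phi (h k *: z)) _ (fun z => M * bump z)).
  - move=> k; apply: measurable_funM.
      by apply: continuous_measurable_rV; exact: bump_continuous.
    apply: (measurableT_comp (continuous_measurable_rV cphi)).
    exact: measurable_scale_rV.
  - move=> z _; apply: cvgM; first exact: cvg_cst.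
    have hz : h k *: z @[k --> \oo] --> (0 : R) *: z by exact: cvgZr_tmp.
    rewrite scale0r in hz.
    exact: (cvg_comp _ _ hz (cphi 0)).
  - by apply: (@integrableZl _ _ _ _ _ measurableT M (EFin \o _)); exact: integrable_bump.
  - move=> k z _; rewrite normrM mulrC ler_pM//.
    by rewrite ger0_norm ?bump_ge0.
have E k : (\int[@leb R n]_x (F k x)%:E =
    - \int[@leb R n]_z (bump z * phi (h k *: z))%:E)%E.
  by rewrite -(rescaled_bump (h0 k) C1) -(regularized_distribution C1)// exprn_gt0.
have cvN : (- (\int[@leb R n]_z (bump z * phi (h k *: z)%R)%:E))%E @[k --> \oo] -->
    (- (\int[@leb R n]_z (bump z * phi 0%R)%:E))%E by exact: (cvgeN cvR).
rewrite -(cvg_lim (@ereal_hausdorff R) cvL)//; under eq_fun do rewrite E.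
rewrite (cvg_lim (@ereal_hausdorff R) cvN)//; under eq_integral do rewrite mulrC EFinM.
rewrite integralZl//; last exact: integrable_bump.
by rewrite -EFin_riesz_const EFinN EFinM muleC.
Qed.

Lemma kernel_distribution (K : set 'rV[R]_n) phi dphi y : C1_supported K phi dphi ->
  (\int[@leb R n]_x (\sum_i riesz 0 i (x - y) * dphi i x)%:E =
   (- (riesz_const * phi y))%:E)%E.
Proof.
move=> /(C1_supported_translate y) C1.
have := kernel_distribution0 C1; rewrite add0r => <-.
have := integral_leb_affine (- y) ltr01 (integrable_riesz_pairing C1 (lexx 0)).
rewrite expr1n invr1 mul1e => <-.
by apply: eq_integral => x _; rewrite scale1r /= subrK.
Qed.

(** Integrability permits removing the null set [E] from the domain of integration in
    [kernel_distribution]. *)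
Lemma integrable_kernel_pairing (K : set 'rV[R]_n) phi dphi y : C1_supported K phi dphi ->
  (@leb R n).-integrable setT (EFin \o (fun x => \sum_i riesz 0 i (x - y) * dphi i x)).
Proof.
move=> /(C1_supported_translate y) C1.
have ig := integrable_riesz_pairing C1 (lexx 0).
set g := (X in EFin \o X) in ig.
have mg : measurable_fun setT g by apply/measurable_EFinP; exact: measurable_int ig.
have -> : (fun x => \sum_i riesz 0 i (x - y) * dphi i x) = (fun x => g (1 *: x + - y)).
  by apply/funext => x; rewrite /g scale1r subrK.
apply/integrableP; split.
  apply/measurable_EFinP; apply: (measurableT_comp mg); exact: measurable_affine_rV.
rewrite (@ge0_integral_leb_affine R n 1 (- y) (fun x => `|(g x)%:E|)%E)//.
  by rewrite expr1n invr1 mul1e; case/integrableP : ig.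
by apply: measurableT_comp => //; exact: measurable_int ig.
Qed.

End kernel_distribution.

(** * Potentials of Ahlfors regular measures *)

Section distance.
Context {R : realType} {n : nat}.
Variables (E : set 'rV[R]_n).
Hypotheses (cE : closed E) (E0 : E !=set0).
Implicit Types x y : 'rV[R]_n.

Let has_inf_dist x : has_inf [set enorm (x - y) | y in E].
Proof.
case: E0 => Q EQ; split; first by exists (enorm (x - Q)), Q.
by exists 0 => _ [y _ <-]; exact: enorm_ge0.
Qed.

(* Unqualified, [edist] is the extended distance of the library. *)
Lemma edist_ge0 x : 0 <= Defs.edist x E.
Proof.
apply: lb_le_inf; first exact: (has_inf_dist x).1.
by move=> _ [y _ <-]; exact: enorm_ge0.
Qed.

Lemma edist_le x y : E y -> Defs.edist x E <= enorm (x - y).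
Proof. by move=> Ey; apply: ge_inf; [exact: (has_inf_dist x).2|exists y]. Qed.

Lemma edist_gt0 x : ~ E x -> 0 < Defs.edist x E.
Proof.
move=> Ex; have : nbhs x (~` E) by apply: open_nbhs_nbhs; split => //; exact: closed_openC.
move=> /nearP_enorm[e e0 eE]; apply: lt_le_trans e0 _.
apply: lb_le_inf; first exact: (has_inf_dist x).1.
move=> _ [y Ey <-]; rewrite leNgt enormB; apply/negP => /eE; exact.
Qed.

Lemma edist_adherent x (r : R) : Defs.edist x E < r -> exists2 y, E y & enorm (x - y) < r.
Proof.
rewrite -subr_gt0 => /inf_adherent/(_ (has_inf_dist x))[_ [y Ey <-]].
by rewrite -/(Defs.edist x E) subrKC => xy; exists y.
Qed.

Lemma edist_lip x y : Defs.edist x E <= Defs.edist y E + enorm (x - y).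
Proof.
rewrite -lerBlDr; apply: lb_le_inf; first exact: (has_inf_dist y).1.
move=> _ [z Ez <-]; rewrite lerBlDr addrC.
by apply: le_trans (edist_le x Ez) _; exact: ler_enormB3.
Qed.

Lemma edist_continuous : continuous (fun x => Defs.edist x E).
Proof.
move=> x; apply/(@cvgrPdist_lt _ R^o _ (nbhs x)) => e e0; near=> y.
apply: (@le_lt_trans _ _ (enorm (y - x))); last by near: y; exact: near_enorm.
rewrite ler_norml lerNl opprB !lerBlDr addrC edist_lip/= addrC.
by rewrite enormB edist_lip.
Unshelve. all: by end_near. Qed.

End distance.

Section ahlfors.
Context {R : realType} {n : nat}.
Variables (d : R) (E : set 'rV[R]_n) (mu : {measure set 'rV[R]_n -> \bar R}).
Implicit Types x y : 'rV[R]_n.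

(** Ahlfors regularity at all scales: for unbounded [E] the restriction of [r] to radii below the
    diameter disappears. *)
Definition regular_with (C : R) := forall Q (r : R), E Q -> 0 < r ->
  ((C^-1 * r `^ d)%:E <= mu (eball Q r) <= (C * r `^ d)%:E)%E.

Lemma unbounded_nonempty : ~ bounded_set E -> E !=set0.
Proof.
move=> nE; apply/set0P/negP => /eqP E0; apply: nE; rewrite E0.
by exists 0; split => // M _ x.
Qed.

Lemma unbounded_ediam (r : R) : ~ bounded_set E -> (r%:E < ediam E)%E.
Proof.
move=> nE; have [Q EQ] := unbounded_nonempty nE.
rewrite ltNge; apply/negP => Er; apply: nE.
exists (r + enorm Q); split => [|M rM x Ex]; first exact: num_real.
apply/ltW/(le_lt_trans _ rM); apply: le_trans (norm_le_enorm x) _.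
rewrite -{1}(subrK Q x); apply: le_trans (ler_enormD _ _) _; rewrite lerD2r -lee_fin.
by apply: le_trans Er; apply: ereal_sup_ubound; right; exists (x, Q).
Qed.

Lemma ahlfors_regular_with : ~ bounded_set E -> ahlfors_regular_measure d E mu ->
  exists2 C, 1 <= C & regular_with C.
Proof.
move=> nE [_ _ _ [C C1 H]]; exists C => // Q r EQ r0.
by apply: H => //; exact: unbounded_ediam.
Qed.

End ahlfors.

Section potential.
Context {R : realType} {n : nat}.
Variables (d : R) (E : set 'rV[R]_n) (mu : {measure set 'rV[R]_n -> \bar R}).
Variable (C : R).
Hypotheses (d0 : 0 < d) (cE : closed E) (E0 : E !=set0)
  (muE : mu (~` E) = 0%E) (C1 : 1 <= C) (Creg : regular_with d E mu C).
Implicit Types x y : 'rV[R]_n.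

Let C0 : 0 < C. Proof. exact: lt_le_trans C1. Qed.

(** The centre may lie off [E]. A ball meeting [E] at [Q] lies in the ball of radius [2 r] about
    [Q], which costs [2^d]; a ball missing [E] has measure 0. *)
Lemma upper_regular x (r : R) : 0 < r ->
  (mu (eball x r) <= (C * 2 `^ d * r `^ d)%:E)%E.
Proof.
move=> r0; have [[Q [EQ xQ]]|nQ] := pselect (exists Q, E Q /\ enorm (x - Q) < r).
  have r20 : 0 < 2 * r by rewrite mulr_gt0.
  have /andP[_ H] := Creg EQ r20.
  rewrite -mulrA -powRM ?(ltW r0)//; apply: le_trans H.
  apply: le_measure; rewrite ?inE; [exact: measurable_eball..|].
  move=> y; rewrite /eball/= => yx.
  apply: le_lt_trans (ler_enormB3 y x Q) _.
  by rewrite mulr_natl mulr2n ltrD.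
apply: (@le_trans _ _ (mu (~` E))).
  apply: le_measure; rewrite ?inE; first exact: measurable_eball.
    by apply: measurableC; exact: closed_measurable_rV.
  by move=> y yx Ey; apply: nQ; exists y; split => //; rewrite enormB.
by rewrite muE lee_fin !mulr_ge0 ?powR_ge0// ltW.
Qed.

(** Stated for balls of the maximum norm because [finite_on_balls] derives from it the
    sigma-finiteness of [mu] required by Fubini. *)
Lemma finite_ball_measure (e : R) : 0 < e -> (mu (ball (0%R : 'rV[R]_n) e) < +oo)%E.
Proof.
move=> e0; have n0 : 0 < n%:R * e + 1 :> R by rewrite ltr_wpDl// mulr_ge0// ltW.
apply: le_lt_trans (_ : mu (eball 0 (n%:R * e + 1)) < _)%E.
  apply: le_measure; rewrite ?inE; last first.
  - move=> y; rewrite -ball_normE /ball_/= sub0r normrN /eball/= subr0 => ye.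
    by apply: le_lt_trans (enorm_le_norm y) _; rewrite ltr_pwDr// ler_wpM2l// ltW.
  - exact: measurable_eball.
  - by apply: open_measurable_rV; exact: ball_open.
by apply: le_lt_trans (upper_regular 0 n0) _; rewrite ltry.
Qed.

Lemma potential_upper (t : R) : d < t ->
  exists2 K : R, 0 <= K & forall x, ~ E x ->
  (\int[mu]_(y in E) (enorm (x - y) `^ (- t))%:E <= (K * Defs.edist x E `^ (d - t))%:E)%E.
Proof.
move=> dt; have CC : 0 <= C * 2 `^ d by rewrite mulr_ge0 ?powR_ge0// ltW.
have [K K0 H] := @dyadic_outer R n _ d t CC dt (ltW (lt_trans d0 dt)).
exists K => // x Ex; apply: H.
- exact: edist_gt0.
- by move=> r rx; apply: upper_regular; exact: lt_le_trans (edist_gt0 cE E0 Ex) rx.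
- exact: closed_measurable_rV.
- by move=> y; exact: edist_le.
Qed.

Lemma potential_integrable (t : R) x : d < t -> ~ E x ->
  mu.-integrable E (EFin \o (fun y => enorm (x - y) `^ (- t))).
Proof.
move=> dt Ex; apply/integrableP; split.
  by apply/measurable_EFinP; exact: measurable_enorm_sub.
under eq_integral => y _ do rewrite /= ger0_norm ?powR_ge0//.
have [K _ H] := potential_upper dt.
by apply: le_lt_trans (H _ Ex) _; rewrite ltry.
Qed.

(** A point [Q] of [E] within twice the distance [e] from [x] has its ball of radius [e] inside the
    ball of radius [3 e] about [x], and this ball alone carries enough mass. The integral is
    localized so that [weight_integral] only meets a bounded part of [E], of finite [mu] measure. *)
Lemma potential_lower (t : R) : 0 <= t ->
  exists2 c : R, 0 < c & forall x, ~ E x ->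
  ((c * Defs.edist x E `^ (d - t))%:E <=
   \int[mu]_(y in E `&` eball x (3 * Defs.edist x E)) (enorm (x - y) `^ (- t))%:E)%E.
Proof.
move=> t0; exists (3 `^ (- t) * C^-1); first by rewrite mulr_gt0 ?powR_gt0 ?invr_gt0.
move=> x Ex; set e := Defs.edist x E.
have e0 : 0 < e by exact: edist_gt0.
have [|Q EQ xQ] := @edist_adherent _ _ _ E0 x (2 * e).
  by rewrite mulr_natl mulr2n ltrDl.
have mE : measurable E by exact: closed_measurable_rV.
have mB : measurable (E `&` eball x (3 * e)).
  by apply: measurableI => //; exact: measurable_eball.
apply: (@le_trans _ _ (\int[mu]_(y in E `&` eball x (3 * e)) ((3 * e) `^ (- t))%:E)%E).
  rewrite integral_cst//.
  have /andP[H _] := Creg EQ e0.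
  have : (mu (eball Q e) <= mu (E `&` eball x (3 * e)))%E.
    apply: (@le_trans _ _ (mu (E `&` eball Q e) + mu (~` E))%E).
      apply: (@le_trans _ _ (mu ((E `&` eball Q e) `|` ~` E))).
        apply: le_measure; rewrite ?inE; first exact: measurable_eball.
          apply: measurableU; last exact: measurableC.
          by apply: measurableI => //; exact: measurable_eball.
        by move=> y yQ; have [Ey|Ey] := pselect (E y); [left|right].
      apply: measureU2; last exact: measurableC.
      by apply: measurableI => //; exact: measurable_eball.
    rewrite [X in _ + X]muE adde0; apply: le_measure; rewrite ?inE//.
      by apply: measurableI => //; exact: measurable_eball.
    move=> y [Ey yQ]; split => //; rewrite /eball/=.
    apply: le_lt_trans (ler_enormB3 y Q x) _.
    rewrite (_ : 3 * e = e + 2 * e); last by ring.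
    by rewrite ltrD// enormB.
  move=> /(le_trans H) {}H.
  apply: le_trans (lee_wpmul2l _ H); last by rewrite lee_fin powR_ge0.
  rewrite -EFinM lee_fin powRM ?(ltW e0)// powRD; last by rewrite (gt_eqF e0) implybT.
  by rewrite le_eqVlt; apply/orP; left; apply/eqP; ring.
apply: ge0_le_integral => //.
- by move=> y _; rewrite lee_fin powR_ge0.
- by apply/measurable_EFinP; exact: measurable_enorm_sub.
- move=> y [Ey yx]; rewrite lee_fin.
  have xy : 0 < enorm (x - y) by apply: lt_le_trans e0 _; exact: edist_le.
  apply: ler_powR_neg => //; last by rewrite oppr_le0.
  by rewrite enormB ltW.
Qed.

End potential.

(** * Tonelli and Fubini on rectangles *)

Section iterated_integrals.
Local Open Scope ereal_scope.
Context d1 d2 (T1 : measurableType d1) (T2 : measurableType d2) (R : realType).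
Variables (A : set T1) (B : set T2).
Hypotheses (mA : measurable A) (mB : measurable B).

(** Extending [f] by 0 off [A * B] reduces iterated integrals on a rectangle to the full product
    space. *)
Lemma iterated_integral_restrict (m1 : {measure set T1 -> \bar R})
    (m2 : {measure set T2 -> \bar R}) (f : T1 * T2 -> \bar R) :
  \int[m1]_(x in A) \int[m2]_(y in B) f (x, y) =
  \int[m1]_x \int[m2]_y (f \_ (A `*` B)) (x, y).
Proof.
rewrite integral_mkcond; apply: eq_integral => x _; rewrite patchE.
case: ifPn => xA.
  rewrite integral_mkcond; apply: eq_integral => y _.
  by rewrite !patchE in_setX xA.
by rewrite integral0_eq// => y _; rewrite patchE in_setX (negbTE xA).
Qed.

Lemma iterated_integral_restrict2 (m1 : {measure set T1 -> \bar R})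
    (m2 : {measure set T2 -> \bar R}) (f : T1 * T2 -> \bar R) :
  \int[m2]_(y in B) \int[m1]_(x in A) f (x, y) =
  \int[m2]_y \int[m1]_x (f \_ (A `*` B)) (x, y).
Proof.
rewrite integral_mkcond; apply: eq_integral => y _; rewrite patchE.
case: ifPn => yB.
  rewrite integral_mkcond; apply: eq_integral => x _.
  by rewrite !patchE in_setX yB andbT.
by rewrite integral0_eq// => x _; rewrite patchE in_setX (negbTE yB) andbF.
Qed.

Variables (m1 : {sigma_finite_measure set T1 -> \bar R})
  (m2 : {sigma_finite_measure set T2 -> \bar R}).

Lemma tonelli_on (f : T1 * T2 -> \bar R) : measurable_fun setT f ->
  (forall p, 0 <= f p) ->
  \int[m1]_(x in A) \int[m2]_(y in B) f (x, y) =
  \int[m2]_(y in B) \int[m1]_(x in A) f (x, y).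
Proof.
move=> mf f0; rewrite iterated_integral_restrict iterated_integral_restrict2.
apply: fubini_tonelli.
  exact: ((measurable_restrictT f (measurableX mA mB)).1 (measurable_funTS mf)).
by move=> p; apply: erestrict_ge0 => q _; exact: f0.
Qed.

Lemma measurable_iterated1 (f : T1 * T2 -> \bar R) : measurable_fun setT f ->
  (forall p, 0 <= f p) ->
  measurable_fun setT (fun x => \int[m2]_(y in B) f (x, y)).
Proof.
move=> mf f0.
have -> : (fun x => \int[m2]_(y in B) f (x, y)) =
    (fun x => \int[m2]_y (f \_ (setT `*` B)) (x, y)).
  apply/funext => x; rewrite integral_mkcond; apply: eq_integral => y _.
  by rewrite !patchE in_setX in_setT.
apply: (measurable_fun_fubini_tonelli_F (f \_ (setT `*` B))).
  exact: ((measurable_restrictT f (measurableX measurableT mB)).1 (measurable_funTS mf)).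
by move=> p; apply: erestrict_ge0 => q _; exact: f0.
Qed.

Lemma fubini_on (f : T1 * T2 -> \bar R) : measurable_fun setT f ->
  \int[m1]_(x in A) \int[m2]_(y in B) `|f (x, y)| < +oo ->
  \int[m1]_(x in A) \int[m2]_(y in B) f (x, y) =
  \int[m2]_(y in B) \int[m1]_(x in A) f (x, y).
Proof.
move=> mf fi; rewrite iterated_integral_restrict iterated_integral_restrict2.
have mfr : measurable_fun setT (f \_ (A `*` B)).
  exact: ((measurable_restrictT f (measurableX mA mB)).1 (measurable_funTS mf)).
apply: Fubini; apply/(integrable12ltyP m1 m2 mfr).
move: fi; rewrite (iterated_integral_restrict m1 m2 (fun p => `|f p|)).
apply: le_lt_trans; rewrite le_eqVlt; apply/orP; left; apply/eqP.
apply: eq_integral => x _; apply: eq_integral => y _.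
by rewrite !patchE; case: ifPn => //; rewrite abse0.
Qed.

End iterated_integrals.

(** * Joint measurability of kernels in [x - y], obtained coordinatewise *)

Section measurable_difference.
Context {R : realType} {n : nat}.

Lemma measurable_fst_coord (i : 'I_n) :
  measurable_fun setT (fun p : 'rV[R]_n * 'rV[R]_n => p.1 ord0 i).
Proof.
apply: (@measurableT_comp _ _ _ _ _ _ (fun x : 'rV[R]_n => x ord0 i) _ fst) => //.
by apply: continuous_measurable_rV; exact: coord_continuous.
Qed.

Lemma measurable_snd_coord (i : 'I_n) :
  measurable_fun setT (fun p : 'rV[R]_n * 'rV[R]_n => p.2 ord0 i).
Proof.
apply: (@measurableT_comp _ _ _ _ _ _ (fun x : 'rV[R]_n => x ord0 i) _ snd) => //.
by apply: continuous_measurable_rV; exact: coord_continuous.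
Qed.

Lemma measurable_diff_coord (i : 'I_n) :
  measurable_fun setT (fun p : 'rV[R]_n * 'rV[R]_n => (p.1 - p.2) ord0 i).
Proof.
rewrite (_ : (fun p => _) = (fun p : 'rV[R]_n * 'rV[R]_n => p.1 ord0 i - p.2 ord0 i)).
  by apply: measurable_funB; [exact: measurable_fst_coord|exact: measurable_snd_coord].
by apply/funext => p; rewrite !mxE.
Qed.

Lemma measurable_diff_powR (t : R) :
  measurable_fun setT (fun p : 'rV[R]_n * 'rV[R]_n => enorm (p.1 - p.2) `^ t).
Proof.
under eq_fun do rewrite -dotv_powR.
apply: (measurableT_comp (measurable_powR _)).
apply: measurable_sum => i.
by apply: measurable_funM; exact: measurable_diff_coord.
Qed.

Lemma measurable_diff_enorm :
  measurable_fun setT (fun p : 'rV[R]_n * 'rV[R]_n => enorm (p.1 - p.2)).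
Proof.
rewrite (_ : (fun p => _) = (fun p : 'rV[R]_n * 'rV[R]_n => enorm (p.1 - p.2) `^ 1)).
  exact: measurable_diff_powR.
by apply/funext => p; rewrite powRr1// enorm_ge0.
Qed.

Lemma measurable_diff_riesz (i : 'I_n) :
  measurable_fun setT (fun p : 'rV[R]_n * 'rV[R]_n => riesz 0 i (p.1 - p.2)).
Proof.
under eq_fun do rewrite riesz0E.
by apply: measurable_funM; [exact: measurable_diff_coord|exact: measurable_diff_powR].
Qed.

End measurable_difference.

(** * Local integrability of the weight and Lebesgue nullity of [E] *)

Section null_boundary.
Context {R : realType} {n : nat}.
Variables (d : R) (E : set 'rV[R]_n) (mu : {measure set 'rV[R]_n -> \bar R}).
Variable (C : R).
Hypotheses (d0 : 0 < d) (dn : d < n%:R - 1) (n2 : (1 < n)%N)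
  (cE : closed E) (E0 : E !=set0)
  (muE : mu (~` E) = 0%E) (C1 : 1 <= C) (Creg : regular_with d E mu C).
Implicit Types x y : 'rV[R]_n.

Let C0 : 0 < C. Proof. exact: lt_le_trans C1. Qed.

Let mE : measurable E. Proof. exact: closed_measurable_rV. Qed.

Let ball_fin := finite_ball_measure cE muE C1 Creg.

(** The same set function as [mu], now carrying its sigma-finite structure. *)
Let sm : {sigma_finite_measure set 'rV[R]_n -> \bar R} := finite_on_balls ball_fin.

Let tonelli_mu (A B : set 'rV[R]_n) f : measurable A -> measurable B ->
  measurable_fun setT f -> (forall p, 0 <= f p)%E ->
  (\int[@leb R n]_(x in A) \int[mu]_(y in B) f (x, y) =
   \int[mu]_(y in B) \int[@leb R n]_(x in A) f (x, y))%E.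
Proof. by move=> mA mB mf f0; exact: (tonelli_on mA mB (@leb R n) sm mf f0). Qed.

Lemma mu_eball_fin x (r : R) : 0 < r -> (mu (eball x r) < +oo)%E.
Proof.
move=> r0; apply: le_lt_trans (upper_regular cE muE C1 Creg x r0) _.
exact: ltry.
Qed.

(** After exchanging the integrals, the inner one is over [x] and is bounded uniformly in [y], since
    [|x - y|^(1-n)] is locally integrable for Lebesgue measure; the outer one is over a set of
    finite [mu] measure. *)
Lemma local_potential_integral (r s : R) : 0 < r -> 0 < s ->
  (\int[@leb R n]_(x in eball 0 r) \int[mu]_(y in E `&` eball 0 s)
    (enorm (x - y) `^ (- (n%:R - 1)))%:E < +oo)%E.
Proof.
move=> r0 s0; have mB : measurable (E `&` eball 0 s).
  by apply: measurableI => //; exact: measurable_eball.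
have mA := measurable_eball (0 : 'rV[R]_n) r.
have mf : measurable_fun setT (fun p : 'rV[R]_n * 'rV[R]_n =>
    (enorm (p.1 - p.2) `^ (- (n%:R - 1)))%:E).
  by apply/measurable_EFinP; exact: measurable_diff_powR.
rewrite (tonelli_mu mA mB mf); last by move=> p; rewrite lee_fin powR_ge0.
have [||K K0 H] := @dyadic_inner R n (2 ^+ n) n%:R (n%:R - 1) (exprn_ge0 n (ler0n R 2)).
- by rewrite ltrBlDr ltrDl.
- by rewrite subr_gt0 ltr1n.
apply: (@le_lt_trans _ _ (\int[mu]_(y in E `&` eball 0 s)
    (K * (r + s) `^ (n%:R - (n%:R - 1)))%:E)%E).
  apply: ge0_le_integral => //.
  - by move=> y _; apply: integral_ge0 => x _; rewrite lee_fin powR_ge0.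
  - apply: measurable_funTS.
    under eq_fun do under eq_integral do rewrite enormB.
    apply: (@measurable_iterated1 _ _ _ _ _ _ mA (@leb R n)
      (fun p : 'rV[R]_n * 'rV[R]_n => (enorm (p.1 - p.2) `^ (- (n%:R - 1)))%:E)) => //.
    by move=> p; rewrite lee_fin powR_ge0.
  - move=> y [Ey ys] /=.
    under eq_integral do rewrite enormB.
    apply: H => //; first by rewrite addr_gt0.
      by move=> q q0; exact: leb_eball_powR.
    move=> x xr; apply: le_lt_trans (ler_enormB3 y 0 x) _; rewrite addrC ltrD//.
      by move: xr; rewrite /eball/= enormB.
rewrite integral_cst// lte_mul_pinfty//.
  by rewrite lee_fin mulr_ge0// powR_ge0.
apply: le_lt_trans (mu_eball_fin 0 s0).
by apply: le_measure; rewrite ?inE//; exact: measurable_eball.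
Qed.

Lemma weight_integral (r : R) : 0 < r ->
  (\int[@leb R n]_(x in ~` E `&` eball 0 r)
    (Defs.edist x E `^ (- (n%:R - d - 1)))%:E < +oo)%E.
Proof.
move=> r0; have n10 : (0 : R) <= n%:R - 1 by rewrite subr_ge0 ler1n ltnW.
have [c c0 H] := potential_lower cE E0 muE C1 Creg n10.
have [Q EQ] := E0.
(* [L] bounds the distance to [E] from points of the ball of radius [r], so all the balls of radius
   [3 dist(x, E)] from [potential_lower] lie in the ball of radius [s]. *)
pose L := r + enorm Q; pose s := r + 3 * L.
have L0 : 0 < L by rewrite ltr_wpDr// enorm_ge0.
have s0 : 0 < s by rewrite addr_gt0// mulr_gt0.
have fin := local_potential_integral r0 s0.
have mA := measurable_eball (0 : 'rV[R]_n) r.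
have mD : measurable (~` E `&` eball 0 r) by apply: measurableI => //; exact: measurableC.
have mB : measurable (E `&` eball 0 s).
  by apply: measurableI => //; exact: measurable_eball.
pose I x := (\int[mu]_(y in E `&` eball 0 s) (enorm (x - y) `^ (- (n%:R - 1)))%:E)%E.
have I0 x : (0 <= I x)%E by apply: integral_ge0 => y _; rewrite lee_fin powR_ge0.
have mI D : measurable_fun D I.
  apply: measurable_funTS.
  apply: (@measurable_iterated1 _ _ _ _ _ _ mB sm
    (fun p : 'rV[R]_n * 'rV[R]_n => (enorm (p.1 - p.2) `^ (- (n%:R - 1)))%:E)) => //.
    by apply/measurable_EFinP; exact: measurable_diff_powR.
  by move=> p; rewrite lee_fin powR_ge0.
apply: (@le_lt_trans _ _ (\int[@leb R n]_(x in ~` E `&` eball 0 r) ((c^-1)%:E * I x))%E).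
  apply: ge0_le_integral => //.
  - by move=> x _; rewrite lee_fin powR_ge0.
  - apply/measurable_EFinP; apply: (measurableT_comp (measurable_powR _)).
    by apply: continuous_measurable_rV; exact: edist_continuous.
  - by apply: emeasurable_funM => //; exact: mI.
  - move=> x [Ex xr].
    have eL : Defs.edist x E <= L.
      apply: le_trans (edist_le E0 x EQ) _; apply: le_trans (ler_enormD _ _) _.
      by rewrite enormN lerD2r ltW//; move: xr; rewrite /eball/= subr0.
    have := H _ Ex; have -> : d - (n%:R - 1) = - (n%:R - d - 1) by ring.
    move=> Hx; rewrite -(@lee_pmul2l _ c%:E) ?lte_fin// muleA -!EFinM mulfV ?gt_eqF// mul1e.
    apply: le_trans Hx _; apply: ge0_subset_integral => //.
    + by apply: measurableI => //; exact: measurable_eball.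
    + by apply/measurable_EFinP; exact: measurable_enorm_sub.
    + by move=> y _; rewrite lee_fin powR_ge0.
    + move=> y [Ey yx]; split => //; rewrite /eball/=.
      apply: le_lt_trans (ler_enormB3 y x 0) _; rewrite addrC; apply: ltr_leD.
        exact: xr.
      by apply/ltW/(lt_le_trans yx); rewrite ler_pM2l.
rewrite ge0_integralZl//; last by rewrite lee_fin invr_ge0 ltW.
rewrite lte_mul_pinfty// ?lee_fin ?invr_ge0 ?(ltW c0)//.
by apply: le_lt_trans fin; apply: ge0_subset_integral.
Qed.

(** Measure the pairs at distance less than [q], with [x] in [E] near the origin: each [x] sees [mu]
    mass at least [C^-1 q^d], while each [y] sees Lebesgue mass at most [(2 q)^n]. Since [d < n],
    small [q] leaves no room for positive Lebesgue measure. *)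
Lemma leb_boundary_ball (r : R) : 0 < r -> @leb R n (E `&` eball 0 r) = 0%E.
Proof.
move=> r0.
have mA : measurable (E `&` eball 0 r).
  by apply: measurableI => //; exact: measurable_eball.
have mB : measurable (eball (0 : 'rV[R]_n) (r + 1)) by exact: measurable_eball.
have r10 : 0 < r + 1 by rewrite addr_gt0.
pose M : R := fine (mu (eball 0 (r + 1))).
have ME : mu (eball 0 (r + 1)) = M%:E.
  by rewrite fineK// ge0_fin_numE// mu_eball_fin.
have M0 : 0 <= M by rewrite -lee_fin -ME.
have key (q : R) : 0 < q -> q <= 1 ->
    ((C^-1 * q `^ d)%:E * @leb R n (E `&` eball 0 r) <= (M * 2 ^+ n * q `^ n%:R)%:E)%E.
  move=> q0 q1.
  (* Writing closeness as the indicator of a half-line composed with [enorm (p.1 - p.2)] makes it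
     jointly measurable. *)
  pose J : set R := [set` `]-oo, q[].
  have mJ : measurable J by exact: measurable_itv.
  pose f (p : 'rV[R]_n * 'rV[R]_n) : \bar R := (\1_J (enorm (p.1 - p.2)))%:E.
  have mf : measurable_fun setT f.
    apply/measurable_EFinP; apply: (measurableT_comp (measurable_indic mJ)).
    exact: measurable_diff_enorm.
  have f0 p : (0 <= f p)%E by rewrite lee_fin.
  have fE x (y : 'rV[R]_n) : f (x, y) = (\1_(eball x q) y)%:E.
    by rewrite /f !indicE; congr ((_ : bool)%:R%:E);
      apply/idP/idP; rewrite !inE /J /eball/= in_itv/= enormB.
  have fE2 x (y : 'rV[R]_n) : f (x, y) = (\1_(eball y q) x)%:E.
    by rewrite fE !indicE; congr ((_ : bool)%:R%:E);
      apply/idP/idP; rewrite !inE /eball/= enormB.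
  apply: (@le_trans _ _ (\int[@leb R n]_(x in E `&` eball 0 r)
      \int[mu]_(y in eball 0 (r + 1)) f (x, y))%E).
    rewrite -integral_cst//; apply: ge0_le_integral => //.
    - by move=> x _; rewrite lee_fin mulr_ge0 ?powR_ge0 ?invr_ge0 ?(ltW C0).
    - by apply: measurable_funTS; exact: (@measurable_iterated1 _ _ _ _ _ _ mB sm f).
    - move=> x [Ex xr] /=.
      under eq_integral do rewrite fE.
      rewrite integral_indic//; last exact: measurable_eball.
      have /andP[H _] := Creg Ex q0; apply: le_trans H _.
      apply: le_measure; rewrite ?inE; first exact: measurable_eball.
        by apply: measurableI => //; exact: measurable_eball.
      move=> y yx; split => //; rewrite /eball/=.
      apply: le_lt_trans (ler_enormB3 y x 0) _; rewrite addrC ltrD//.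
      exact: lt_le_trans yx q1.
  rewrite (tonelli_mu mA mB mf f0).
  apply: (@le_trans _ _ (\int[mu]_(y in eball 0%R (r + 1)) (2 ^+ n * q `^ n%:R)%:E)%E).
    apply: ge0_le_integral => //.
    - by move=> y _; apply: integral_ge0 => x _.
    - apply: measurable_funTS.
      rewrite (_ : (fun y => _) = (fun y : 'rV[R]_n =>
          \int[@leb R n]_(x in E `&` eball 0 r) f (y, x))%E).
        exact: (@measurable_iterated1 _ _ _ _ _ _ mA (@leb R n) f).
      by apply/funext => y; apply: eq_integral => x _; rewrite fE fE2.
    - move=> y _ /=; under eq_integral do rewrite fE2.
      rewrite integral_indic//; last exact: measurable_eball.
      apply: le_trans (leb_eball_powR y q0).
      apply: le_measure; rewrite ?inE; last by move=> z [].
        by apply: measurableI => //; exact: measurable_eball.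
      exact: measurable_eball.
  rewrite integral_cst// ME -EFinM lee_fin.
  by rewrite le_eqVlt; apply/orP; left; apply/eqP; ring.
have lfin : @leb R n (E `&` eball 0 r) \is a fin_num.
  rewrite ge0_fin_numE//; apply: le_lt_trans (_ : @leb R n (eball 0 r) < _)%E.
    by apply: le_measure; rewrite ?inE//; exact: measurable_eball.
  by apply: le_lt_trans (leb_eball 0 r0) _; rewrite ltry.
pose l : R := fine (@leb R n (E `&` eball 0 r)).
have lE : @leb R n (E `&` eball 0 r) = l%:E by rewrite fineK.
have l0 : 0 <= l by rewrite -lee_fin -lE.
rewrite lE; congr EFin; apply/eqP; rewrite eq_le l0 andbT leNgt; apply/negP => lpos.
pose K := M * 2 ^+ n * C + 1.
have K0 : 0 < K by rewrite ltr_wpDl// !mulr_ge0// ltW.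
have nd : 0 < n%:R - d by rewrite subr_gt0 (lt_le_trans dn)// gerBl.
(* [q^(n-d) = a <= l/(2K)], so that [key] at [q] gives [l <= l/2]. *)
pose a := Num.min 1 (l / 2 / K).
have a0 : 0 < a by rewrite lt_min ltr01/= !divr_gt0.
pose q := a `^ (n%:R - d)^-1.
have q0 : 0 < q by exact: powR_gt0.
have q1 : q <= 1.
  have [a1 | ] := leP a 1; last by rewrite ltNge ge_min lexx.
  have := @ge0_ler_powR R (n%:R - d)^-1; rewrite invr_ge0 => /(_ (ltW nd) a 1).
  by rewrite powR1 !nnegrE ler01 (ltW a0) a1; apply.
have qn : q `^ (n%:R - d) = a by rewrite -powRrM mulVf ?gt_eqF// powRr1// ltW.
have := key q q0 q1; rewrite lE -EFinM lee_fin.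
have -> : q `^ n%:R = q `^ d * a by rewrite -qn -powRD ?subrKC// (gt_eqF q0) implybT.
have qd : 0 < q `^ d by exact: powR_gt0.
rewrite -(ler_pM2l C0) -(ler_pM2l (_ : 0 < (q `^ d)^-1)) ?invr_gt0//.
have -> : (q `^ d)^-1 * (C * (C^-1 * q `^ d * l)) = l.
  by field; rewrite !gt_eqF.
have -> : (q `^ d)^-1 * (C * (M * 2 ^+ n * (q `^ d * a))) = (K - 1) * a.
  by rewrite /K; field; rewrite !gt_eqF.
have aK : a <= l / 2 / K by rewrite ge_min lexx orbT.
move=> h; have : (K - 1) * a < l.
  apply: (@le_lt_trans _ _ (K * a)); first by rewrite ler_pM2r// gerBl.
  apply: (@le_lt_trans _ _ (l / 2)); last by rewrite ltr_pdivrMr// mulr_natr mulr2n ltrDl.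
  by rewrite mulrC -ler_pdivlMr.
by rewrite ltNge h.
Qed.

Lemma leb_boundary : @leb R n E = 0%E.
Proof.
apply/eqP; rewrite -measure_le0.
have -> : E = \bigcup_k (E `&` eball 0 k.+1%:R).
  rewrite -setI_bigcupr; apply/seteqP; split => [x Ex|x []//]; split => //.
  exists (Num.truncn (enorm x)) => //; rewrite /eball/= subr0; exact: truncnS_gt.
apply: le_trans (measure_sigma_subadditive _ _ _ (@subset_refl _ _)) _.
- by move=> k; apply: measurableI => //; exact: measurable_eball.
- apply: bigcup_measurable => k _; apply: measurableI => //; exact: measurable_eball.
- by rewrite eseries0// => k _ _; exact: leb_boundary_ball.
Qed.

End null_boundary.

(** * Regularity and growth of the Newtonian potential off [E] *)

Section potential_smoothness.
Context {R : realType} {n : nat}.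
Variables (d : R) (E : set 'rV[R]_n) (mu : {measure set 'rV[R]_n -> \bar R}).
Variable (C : R).
Hypotheses (d0 : 0 < d) (dn : d < n%:R - 2)
  (cE : closed E) (E0 : E !=set0)
  (muE : mu (~` E) = 0%E) (C1 : 1 <= C) (Creg : regular_with d E mu C).
Implicit Types x y z : 'rV[R]_n.

Let mE : measurable E. Proof. exact: closed_measurable_rV. Qed.

Let dn1 : d < n%:R - 1.
Proof. by apply: lt_trans dn _; rewrite ltrD2l ltrN2 ltr1n. Qed.

(** Moving [x0] by less than half its distance to [E] at most halves the distance to each point of
    [E]. Hence kernels at nearby points are dominated by a multiple of the kernel at [x0]. *)
Lemma half_distance x0 x y : E y -> enorm (x - x0) < Defs.edist x0 E / 2 ->
  enorm (x0 - y) / 2 <= enorm (x - y).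
Proof.
move=> Ey xx0; have h1 := edist_le E0 x0 Ey; have := ler_enormB3 x0 x y.
rewrite (enormB x0 x); lra.
Qed.

Lemma half_distance_off x0 x : ~ E x0 -> enorm (x - x0) < Defs.edist x0 E / 2 -> ~ E x.
Proof.
move=> Ex0 xx0 Ex; have := half_distance Ex xx0.
rewrite subrr enorm0; have := edist_le E0 x0 Ex; have := edist_gt0 cE E0 Ex0; lra.
Qed.

Lemma half_distance_powR x0 x y (t : R) : 0 <= t -> ~ E x0 -> E y ->
  enorm (x - x0) < Defs.edist x0 E / 2 ->
  enorm (x - y) `^ (- t) <= 2 `^ t * enorm (x0 - y) `^ (- t).
Proof.
move=> t0 Ex0 Ey xx0.
have p : 0 < enorm (x0 - y).
  by apply: lt_le_trans (edist_gt0 cE E0 Ex0) _; exact: edist_le.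
have -> : 2 `^ t * enorm (x0 - y) `^ (- t) = (enorm (x0 - y) / 2) `^ (- t).
  rewrite powRM ?invr_ge0 ?(ltW p)// mulrC; congr (_ * _).
  by rewrite -(powR_inv1 (ler0n R 2)) -powRrM mulrNN mul1r.
apply: ler_powR_neg; rewrite ?oppr_le0//; first by rewrite divr_gt0.
exact: half_distance.
Qed.

(** Stated for a general kernel so as to serve both [newton] and [rieszpot]; the proof is by
    dominated convergence along a sequence. *)
Lemma continuous_potential (F : 'rV[R]_n -> 'rV[R]_n -> R) (t M : R) x0 :
  d < t -> ~ E x0 -> (forall x, measurable_fun E (F x)) ->
  (forall x y, enorm (x - x0) < Defs.edist x0 E / 2 -> E y ->
    `|F x y| <= M * enorm (x0 - y) `^ (- t)) ->
  (forall y, E y -> {for x0, continuous (F ^~ y)}) ->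
  {for x0, continuous (fun x => \int[mu]_(y in E) F x y)}.
Proof.
move=> dt Ex0 mF FM cF.
have e0 : 0 < Defs.edist x0 E / 2 by rewrite divr_gt0//; exact: edist_gt0.
have ig : mu.-integrable E (EFin \o (fun y => M * enorm (x0 - y) `^ (- t))).
  apply: (@integrableZl _ _ _ _ _ mE M (EFin \o _)).
  exact: (potential_integrable d0 cE E0 muE C1 Creg).
have iF x : enorm (x - x0) < Defs.edist x0 E / 2 -> mu.-integrable E (EFin \o F x).
  by move=> xx0; apply: (le_integrableR mE _ ig) => // y Ey; exact: FM.
apply/(@cvgrPdist_lt _ R^o _ (nbhs x0)) => e e_gt0; apply: contrapT => H.
(* If continuity failed at tolerance [e], every ball about [x0] would contain a bad point; the
   minimum makes these points converge to [x0] while staying where [FM] applies. *)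
have ex k : exists x, enorm (x - x0) < Num.min (harmonic k) (Defs.edist x0 E / 2) /\
    e <= `|\int[mu]_(y in E) F x0 y - \int[mu]_(y in E) F x y|.
  apply: contrapT => /forallNP nH; apply: H; apply/nearP_enorm.
  exists (Num.min (harmonic k) (Defs.edist x0 E / 2)).
    by rewrite lt_min e0 harmonic_gt0.
  by move=> x xx0; rewrite ltNge; apply/negP => ex; apply: (nH x).
have [u uP] := choice ex.
have ux k : enorm (u k - x0) < Defs.edist x0 E / 2.
  by have [+ _] := uP k; rewrite lt_min => /andP[].
have uc : u k @[k --> \oo] --> x0.
  move=> P /nearP_enorm[r r0 rP].
  have := @cvg_harmonic R; move/cvgr_lt => /(_ r r0).
  apply: filterS => k kr; apply: rP; apply: lt_trans kr.
  by have [+ _] := uP k; rewrite lt_min => /andP[].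
have cint : (\int[mu]_(y in E) (F (u k) y)%:E @[k --> \oo] -->
    \int[mu]_(y in E) (F x0 y)%:E)%E.
  apply: (dominated_cvgR mE (g := fun y => M * enorm (x0 - y) `^ (- t))) => //.
  - by move=> y Ey; exact: (cvg_comp _ _ uc (cF y Ey)).
  - by move=> k y Ey; exact: FM.
have x00 : enorm (x0 - x0) < Defs.edist x0 E / 2 by rewrite subrr enorm0.
have : \int[mu]_(y in E) F (u k) y @[k --> \oo] --> \int[mu]_(y in E) F x0 y.
  rewrite /Rintegral; apply: fine_cvg.
  by rewrite fineK//; apply: integrable_fin_num => //; exact: iF.
move=> /(@cvgrPdist_lt _ R^o)/(_ _ e_gt0)[N _ /(_ N (leqnn N))] /=.
by rewrite ltNge (proj2 (uP N)).
Qed.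

(** The potential called [h] in the overview. *)
Definition newton x : R := \int[mu]_(y in E) enorm (x - y) `^ (- (n%:R - 2)).

(** Up to the factor [2 - n], the [i]-th partial derivative of [newton] off [E]. *)
Definition rieszpot (i : 'I_n) x : R := \int[mu]_(y in E) riesz 0 i (x - y).

Let n20 : (0 : R) <= n%:R - 2. Proof. exact: ltW (lt_trans d0 dn). Qed.

Let n10 : (0 : R) <= n%:R - 1. Proof. exact: ltW (lt_trans d0 dn1). Qed.

Lemma off_nonzero x y : ~ E x -> E y -> x - y != 0.
Proof. by move=> Ex Ey; rewrite subr_eq0; apply/eqP => xy; rewrite xy in Ex. Qed.

Lemma sub_continuousr y : continuous (fun x : 'rV[R]_n => x - y).
Proof.
rewrite (_ : (fun x => _) = (fun x => 1 *: x + (- y))); first exact: affine_continuous.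
by apply/funext => x; rewrite scale1r.
Qed.

Lemma measurable_riesz_sub e i x D :
  measurable_fun D (fun y : 'rV[R]_n => riesz e i (x - y)).
Proof.
apply: measurable_funTS; apply: (measurableT_comp (measurable_riesz _ _)).
rewrite (_ : (fun y => _) = (fun y => (-1) *: y + x)); first exact: measurable_affine_rV.
by apply/funext => y; rewrite scaleN1r addrC.
Qed.

Lemma is_derive_newton_kernel x y i : x - y != 0 ->
  is_derive x (delta_mx ord0 i) (fun x => enorm (x - y) `^ (- (n%:R - 2)))
    ((2 - n%:R) * riesz 0 i (x - y)).
Proof.
move=> xy; apply/is_derive_line0.
(* The added 0 puts the kernel in the form of [is_derive_qpow] with [e = 0]. *)
under eq_fun do rewrite -addrA -dotv_powR -[dotv _ _]addr0.
apply/(is_derive_line0 (fun z => (dotv z z + 0) `^ (- (n%:R - 2) / 2))).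
have q0 : 0 < dotv (x - y) (x - y) + 0 by rewrite addr0 -sqr_enorm exprn_gt0// enorm_gt0.
apply: (is_derive_eq (is_derive_qpow (- (n%:R - 2) / 2) (delta_mx ord0 i) q0)).
rewrite dotv_delta /riesz.
have -> : - (n%:R - 2) / 2 - 1 = - n%:R / 2 :> R by field.
by field.
Qed.

Lemma newton_continuous x : ~ E x -> {for x, continuous newton}.
Proof.
move=> Ex; apply: (@continuous_potential _ (n%:R - 2) (2 `^ (n%:R - 2))) => //.
- by move=> z; exact: measurable_enorm_sub.
- by move=> z y zx Ey; rewrite ger0_norm ?powR_ge0//; exact: half_distance_powR.
- move=> y Ey.
  apply: (@continuous_compR _ _ (fun x => enorm (x - y)) (fun t => t `^ (- (n%:R - 2)))).
    by apply: continuous_comp; [exact: sub_continuousr|exact: enorm_continuous].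
  apply: is_derive1_continuous; apply: is_derive1_powR.
  by rewrite enorm_gt0// off_nonzero.
Qed.

Lemma riesz_half_bound x0 x y i : ~ E x0 -> E y ->
  enorm (x - x0) < Defs.edist x0 E / 2 ->
  `|riesz 0 i (x - y)| <= 2 `^ (n%:R - 1) * enorm (x0 - y) `^ (- (n%:R - 1)).
Proof.
move=> Ex0 Ey xx0; apply: le_trans (riesz_bound _ _ (lexx 0)) _.
by rewrite -(opprB n%:R); exact: half_distance_powR.
Qed.

Lemma rieszpot_continuous i x : ~ E x -> {for x, continuous (rieszpot i)}.
Proof.
move=> Ex; apply: (@continuous_potential _ (n%:R - 1) (2 `^ (n%:R - 1))) => //.
- by move=> z; exact: measurable_riesz_sub.
- by move=> z y zx Ey; exact: riesz_half_bound.
- move=> y Ey; apply: (@continuous_comp _ _ _ (fun x => x - y) (riesz 0 i)).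
    exact: sub_continuousr.
  by apply: riesz0_continuous; exact: off_nonzero.
Qed.

Lemma riesz_integrable i x : ~ E x ->
  mu.-integrable E (EFin \o (fun y => riesz 0 i (x - y))).
Proof.
move=> Ex; apply: (le_integrableR mE _ (potential_integrable d0 cE E0 muE C1 Creg dn1 Ex)).
  exact: measurable_riesz_sub.
by move=> y Ey; rewrite opprB; exact: riesz_bound.
Qed.

(** Differentiation under the integral on the segment [|s| < dist(x, E) / 2], where
    [riesz_half_bound] supplies the integrable majorant [G]. *)
Lemma is_derive_newton x i : ~ E x ->
  is_derive x (delta_mx ord0 i) newton ((2 - n%:R) * rieszpot i x).
Proof.
move=> Ex; apply/is_derive_line0.
pose f (s : R) y := enorm (s *: delta_mx ord0 i + x - y) `^ (- (n%:R - 2)).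
pose e := Defs.edist x E / 2.
have e0 : 0 < e by rewrite divr_gt0//; exact: edist_gt0.
have de : enorm (delta_mx ord0 i : 'rV[R]_n) = 1.
  by rewrite /enorm dotv_delta mxE !eqxx sqrtr1.
have near_x s : s \in `](- e), e[ -> enorm (s *: delta_mx ord0 i + x - x) < e.
  by rewrite in_itv/= addrK enormZ de mulr1 ltr_norml.
have off s : s \in `](- e), e[ -> ~ E (s *: delta_mx ord0 i + x).
  by move=> /near_x; exact: half_distance_off.
have df s y : s \in `](- e), e[ -> E y -> is_derive s 1 (f ^~ y)
    ((2 - n%:R) * riesz 0 i (s *: delta_mx ord0 i + x - y)).
  move=> se Ey.
  have := @is_derive_newton_kernel (s *: delta_mx ord0 i + x) y i
    (off_nonzero (off s se) Ey).
  by move/is_derive_line.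
have z0 : (0 : R) \in `](- e), e[ by rewrite in_itv/= oppr_lt0 e0.
pose G y := (n%:R - 2) * (2 `^ (n%:R - 1) * enorm (x - y) `^ (- (n%:R - 1))).
have G0 y : 0 <= G y by rewrite !mulr_ge0// powR_ge0.
have iG : mu.-integrable E (EFin \o G).
  apply: (@integrableZl _ _ _ _ _ mE _ (EFin \o _)).
  apply: (@integrableZl _ _ _ _ _ mE _ (EFin \o _)).
  exact: (potential_integrable d0 cE E0 muE C1 Creg).
have If s : [set` `](- e), e[] s -> mu.-integrable E (EFin \o f s).
  by move=> se; apply: (potential_integrable d0 cE E0 muE C1 Creg dn); exact: off.
have D1 s y : [set` `](- e), e[] s -> E y -> derivable (f ^~ y) s 1.
  by move=> se Ey; exact: (@ex_derive _ _ _ _ _ _ _ (df s y se Ey)).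
have D2 s y : [set` `](- e), e[] s -> E y -> partial1of2 f s y =
    (2 - n%:R) * riesz 0 i (s *: delta_mx ord0 i + x - y).
  by move=> se Ey; rewrite partial1of2E; exact: (@derive_val _ _ _ _ _ _ _ (df s y se Ey)).
have Gub s y : [set` `](- e), e[] s -> E y -> `|partial1of2 f s y| <= G y.
  move=> se Ey; rewrite D2// normrM distrC (ger0_norm n20) ler_wpM2l//.
  by apply: riesz_half_bound => //; exact: near_x.
have := @derivable_under_integral R _ _ mu f E mE 0 (- e) e z0 If D1 G G0 iG Gub.
have := @differentiation_under_integral R _ _ mu f E mE 0 (- e) e z0 If D1 G G0 iG Gub.
move=> e1 e2; apply: DeriveDef; first exact: e2.
rewrite -derive1E [LHS]e1 -RintegralZl//; last exact: riesz_integrable.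
apply: eq_Rintegral => y; rewrite inE => Ey.
by rewrite D2// scale0r add0r.
Qed.

Lemma newton_lower : exists2 c : R, 0 < c & forall x, ~ E x ->
  c * Defs.edist x E `^ (- (n%:R - d - 2)) <= newton x.
Proof.
have [c c0 H] := potential_lower cE E0 muE C1 Creg n20.
exists c => // x Ex; rewrite -lee_fin /newton fineK; last first.
  by apply: integrable_fin_num => //; exact: (potential_integrable d0 cE E0 muE C1 Creg).
have -> : - (n%:R - d - 2) = d - (n%:R - 2) by ring.
apply: le_trans (H _ Ex) _; apply: ge0_subset_integral => //.
- by apply: measurableI => //; exact: measurable_eball.
- by apply/measurable_EFinP; exact: measurable_enorm_sub.
- by move=> y _; rewrite lee_fin powR_ge0.
Qed.

Lemma newton_gt0 x : ~ E x -> 0 < newton x.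
Proof.
move=> Ex; have [c c0 H] := newton_lower; apply: lt_le_trans (H _ Ex).
by rewrite mulr_gt0 ?powR_gt0//; exact: edist_gt0.
Qed.

(** The absolute value is inside the integral, as the absolute convergence required by Fubini
    demands. *)
Lemma rieszpot_abs_upper : exists2 K : R, 0 <= K & forall i x, ~ E x ->
  (\int[mu]_(y in E) `|(riesz 0 i (x - y))%:E| <=
    (K * Defs.edist x E `^ (- (n%:R - d - 1)))%:E)%E.
Proof.
have [K K0 H] := potential_upper d0 cE E0 muE C1 Creg dn1.
exists K => // i x Ex.
have -> : - (n%:R - d - 1) = d - (n%:R - 1) by ring.
apply: le_trans (H _ Ex); apply: ge0_le_integral => //.
- apply/measurable_EFinP; apply: measurableT_comp => //; exact: measurable_riesz_sub.
- by apply/measurable_EFinP; exact: measurable_enorm_sub.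
- by move=> y Ey /=; rewrite lee_fin opprB; exact: riesz_bound.
Qed.

Lemma rieszpot_upper : exists2 K : R, 0 <= K & forall i x, ~ E x ->
  `|rieszpot i x| <= K * Defs.edist x E `^ (- (n%:R - d - 1)).
Proof.
have [K K0 H] := rieszpot_abs_upper; exists K => // i x Ex.
apply: le_trans (le_normr_Rintegral mE (riesz_integrable i Ex)) _.
rewrite -lee_fin fineK; first exact: H.
have := integrable_norm (riesz_integrable i Ex).
by apply: integrable_fin_num.
Qed.

End potential_smoothness.

(** * Weak gradients of C^1 functions *)

Section general_integrals.
Context {R : realType}.

(** Test functions change sign, so the scaling rule is needed beyond nonnegative integrands. *)
Lemma integral_mscale d (T : measurableType d) (m : {measure set T -> \bar R})
    (D : set T) (k : {nonneg R}) (f : T -> \bar R) : measurable D ->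
  m.-integrable D f ->
  (\int[mscale k m]_(x in D) f x = k%:num%:E * \int[m]_(x in D) f x)%E.
Proof.
move=> mD fi; have mf := measurable_int _ fi.
rewrite [in RHS]integralE [LHS]integralE muleBr//; last first.
  apply: fin_num_adde_defr; apply: integrable_fin_num => //.
  exact: integrable_funepos.
rewrite !ge0_integral_mscale//.
- exact: measurable_funeneg.
- exact: measurable_funepos.
Qed.

Lemma integral_support d (T : measurableType d) (m : {measure set T -> \bar R})
    (D : set T) (f : T -> \bar R) : (forall x, ~ D x -> f x = 0%E) ->
  (\int[m]_(x in D) f x = \int[m]_x f x)%E.
Proof.
move=> f0; rewrite integral_mkcond; apply: eq_integral => x _; rewrite patchE.
by case: ifPn => //; rewrite notin_setE => /f0.
Qed.

End general_integrals.

Section classical_weak_gradient.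
Context {R : realType} {n : nat}.
Implicit Types (O E K : set 'rV[R]_n) (u v phi : 'rV[R]_n -> R) (x : 'rV[R]_n).

Lemma test_function_C1 O phi : test_function O phi ->
  exists2 K, K `<=` O & C1_supported K phi (fun i => partial i phi).
Proof.
move=> [sphi [K [cK KO phi0]]]; exists K => //; split => //.
- by have [] := sphi 1%N.
- move=> i x; have [_ /(_ i)[+ _]] := sphi 1%N => /(_ x) dphi.
  exact: DeriveDef.
- by move=> i; have [_ /(_ i)[_]] := sphi 1%N.
Qed.

Lemma L1loc_continuous O u : open O ->
  (forall x, O x -> {for x, continuous u}) -> L1loc O u.
Proof.
move=> oO cu K cK KO.
have clK : closed K by apply: compact_closed => //; exact: norm_hausdorff.
have mK : measurable K by exact: closed_measurable_rV.
have [M M0 uM] := compact_support_bounded cK (fun x Kx => cu x (KO x Kx)).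
have [r r0 Kr] := compact_enorm cK.
apply: (@le_integrableR _ _ _ (@leb R n) K mK _
  (fun y => M * \1_(eball (0 : 'rV[R]_n) r) y)).
- apply: (measurable_funS (open_measurable_rV oO) KO).
  exact: measurable_fun_open_continuous.
- exact: (integrableS measurableT mK (@subsetT _ _) (integrable_eball M 0 r0)).
- move=> x Kx; rewrite indicE mem_set ?mulr1; first exact: uM.
  by rewrite /eball/= subr0; exact: Kr.
Qed.

Lemma continuous_near_eq u v x : (\forall y \near x, u y = v y) ->
  {for x, continuous u} -> {for x, continuous v}.
Proof.
move=> uv cu; have ux : u x = v x by exact: (nbhs_singleton uv).
apply/(@cvgrPdist_lt _ R^o _ (nbhs x)) => e e0; near=> y.
have <- : u y = v y by near: y.
rewrite -ux; near: y; move: e e0; exact/(@cvgrPdist_lt _ R^o _ (nbhs x)).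
Unshelve. all: by end_near. Qed.

Lemma continuous_near0 u x : (\forall y \near x, 0 = u y) -> {for x, continuous u}.
Proof. by move=> u0; apply: continuous_near_eq u0 _; exact: continuous_cst. Qed.

Lemma off_compact_support K (P : set 'rV[R]_n) x : closed K -> ~ K x ->
  (forall y, ~ K y -> P y) -> \forall y \near x, P y.
Proof.
move=> clK Kx KP.
have : nbhs x (~` K) by apply: open_nbhs_nbhs; split => //; exact: closed_openC.
by apply: filterS => y /KP.
Qed.

(** Nothing is known of [u] and [g] off [O], but [phi] vanishes in a neighbourhood of every point
    outside the closed set [K], so the product is C^1 on the whole space. *)
Lemma cutoff_C1 O K u (g : 'I_n -> 'rV[R]_n -> R) phi dphi : K `<=` O ->
  C1_supported K phi dphi -> (forall x, O x -> {for x, continuous u}) ->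
  (forall i x, O x -> is_derive x (delta_mx ord0 i) u (g i x)) ->
  (forall i x, O x -> {for x, continuous (g i)}) ->
  C1_supported K (fun x => u x * phi x) (fun i x => g i x * phi x + u x * dphi i x).
Proof.
move=> KO C1 cu ug cg; have clK := C1_supported_closed C1.
case: (C1) => cK phi0 cphi phiE cdphi.
have dphi0 := C1_supported_partial0 C1.
have glue (w : 'rV[R]_n -> R) : (forall x, ~ K x -> w x = 0) ->
    (forall x, O x -> {for x, continuous w}) -> continuous w.
  move=> w0 cw x; have [/KO/cw//|Kx] := pselect (K x).
  by apply: continuous_near0; apply: (off_compact_support clK Kx) => y /w0.
split => //.
- by move=> x /phi0 ->; rewrite mulr0.
- apply: glue => [x /phi0 ->|x Ox]; first by rewrite mulr0.
  by apply: continuous_mul; [exact: cu|exact: cphi].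
- move=> i x; have [Kx|Kx] := pselect (K x).
    by apply: is_derive_mul; exact: ug (KO _ Kx).
  rewrite phi0// dphi0// !mulr0 addr0.
  apply: (@near_eq_is_derive _ _ _ (cst 0)).
  by apply: (off_compact_support clK Kx) => y /phi0 ->; rewrite mulr0.
- move=> i; apply: glue => [x Kx|x Ox]; first by rewrite phi0// dphi0// !mulr0 addr0.
  apply: (@continuous_add _ _ (fun x => g i x * phi x) (fun x => u x * dphi i x)).
    by apply: continuous_mul; [exact: cg|exact: cphi].
  by apply: continuous_mul; [exact: cu|exact: cdphi].
Qed.

(** The product [u * phi] is C^1 with compact support, so its derivative has integral 0 over the
    whole space; the product rule then gives the weak identity. *)
Lemma weak_gradient_classical O u (g : 'I_n -> 'rV[R]_n -> R) : open O ->
  (forall x, O x -> {for x, continuous u}) ->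
  (forall i x, O x -> is_derive x (delta_mx ord0 i) u (g i x)) ->
  (forall i x, O x -> {for x, continuous (g i)}) ->
  weak_gradient O u (fun x => \row_i g i x).
Proof.
move=> oO cu ug cg i; split.
  rewrite (_ : (fun x => _) = g i); last by apply/funext => x; rewrite mxE.
  by apply: L1loc_continuous => // x; exact: cg.
move=> phi /test_function_C1[K KO C1].
case: (cutoff_C1 KO C1 cu ug cg) => cK uphi0 cuphi dE cd.
have [idf df0] := integral_is_derive0 cK uphi0 cuphi (dE i) (cd i).
case: (C1) => _ phi0 cphi phiE cdphi.
have dphi0 := C1_supported_partial0 C1.
have clK := C1_supported_closed C1.
have offK x : ~ O x -> ~ K x by move=> Ox /KO.
rewrite [LHS]integral_support => [|x Ox]; last by rewrite (dphi0 _ _ (offK _ Ox)) mulr0.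
rewrite [X in _ = (- X)%E]integral_support => [|x Ox]; last first.
  by rewrite (phi0 _ (offK _ Ox)) mulr0.
under [in RHS]eq_integral do rewrite mxE.
have ig : (@leb R n).-integrable setT (EFin \o (fun x => g i x * phi x)).
  apply: (C1_supported_integrable C1) => [x|x Kx]; last by rewrite phi0// mulr0.
  have [/KO Ox|Kx] := pselect (K x).
    by apply: continuous_mul; [exact: cg|exact: cphi].
  apply: continuous_near0; apply: (off_compact_support clK Kx) => y /phi0 ->.
  by rewrite mulr0.
have -> : (\int[@leb R n]_x (u x * partial i phi x)%:E =
    \int[@leb R n]_x ((EFin \o (fun x => (g i x * phi x + u x * partial i phi x)%R)) x -
      (EFin \o (fun x => (g i x * phi x)%R)) x))%E.
  by apply: eq_integral => x _; rewrite /= -EFinB addrAC subrr add0r.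
by rewrite integralB// df0 sub0e.
Qed.

End classical_weak_gradient.

(** * The Green function *)

Section green_function.
Context {R : realType} {n : nat}.
Variables (d : R) (E : set 'rV[R]_n) (mu : {measure set 'rV[R]_n -> \bar R}).
Variable (C : R).
Hypotheses (d0 : 0 < d) (dn : d < n%:R - 2)
  (cE : closed E) (E0 : E !=set0)
  (muE : mu (~` E) = 0%E) (C1 : 1 <= C) (Creg : regular_with d E mu C).
Implicit Types x y z : 'rV[R]_n.

Local Notation alpha := (n%:R - d - 2).

Let mE : measurable E. Proof. exact: closed_measurable_rV. Qed.

Let a0 : 0 < alpha. Proof. by rewrite subr_gt0 ltrBrDr addrC -ltrBrDr. Qed.

Let n_gt2 : (2 : R) < n%:R.
Proof. by rewrite -subr_gt0 (lt_trans d0). Qed.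

Let n2 : (1 < n)%N.
Proof. by rewrite ltnW// -(ltr_nat R). Qed.

Let dn1 : d < n%:R - 1.
Proof. by apply: lt_trans dn _; rewrite ltrD2l ltrN2 ltr1n. Qed.

Let oE : open (~` E). Proof. exact: closed_openC. Qed.

Definition green x : R := if x \in E then 0 else Dmu d E mu alpha x.

(** The chain rule for [newton^(-1/alpha)]: the constant is the product of [- 1 / alpha] and
    [2 - n]. *)
Definition green_partial i x : R :=
  (n%:R - 2) / alpha * newton E mu x `^ (- alpha^-1 - 1) * rieszpot E mu i x.

(** For this [alpha] the exponent [- d - alpha] is [- (n - 2)], so the integral defining [Dmu] is
    the Newtonian potential. *)
Lemma DmuE x : Dmu d E mu alpha x = newton E mu x `^ (- alpha^-1).
Proof.
have -> : newton E mu x = \int[mu]_(y in E) enorm (x - y) `^ (- d - alpha).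
  by apply: eq_Rintegral => y _; congr (_ `^ _); ring.
by [].
Qed.

Lemma green_offE x : ~ E x -> green x = newton E mu x `^ (- alpha^-1).
Proof.
move=> Ex; rewrite /green; case: ifPn => [|_]; first by rewrite inE => /Ex.
exact: DmuE.
Qed.

Lemma green_onE x : E x -> green x = 0.
Proof. by move=> Ex; rewrite /green; case: ifPn => //; rewrite notin_setE => /(_ Ex). Qed.

Let newton_pos := newton_gt0 d0 dn cE E0 muE C1 Creg.

Lemma green_gt0 x : ~ E x -> 0 < green x.
Proof. by move=> Ex; rewrite green_offE// powR_gt0//; exact: newton_pos. Qed.

Lemma near_green x : ~ E x ->
  \forall y \near x, newton E mu y `^ (- alpha^-1) = green y.
Proof.
move=> Ex; have : nbhs x (~` E) by exact: open_nbhs_nbhs.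
by apply: filterS => y Ey; rewrite green_offE.
Qed.

Lemma newton_powR_continuous (s : R) x : ~ E x ->
  {for x, continuous (fun y => newton E mu y `^ s)}.
Proof.
move=> Ex; apply: (@continuous_compR _ _ (newton E mu) (fun t => t `^ s)).
  exact: (newton_continuous d0 dn cE E0 muE C1 Creg).
by apply: is_derive1_continuous; apply: is_derive1_powR; exact: newton_pos.
Qed.

Lemma green_continuous_off x : ~ E x -> {for x, continuous green}.
Proof.
move=> Ex; apply: (continuous_near_eq (near_green Ex)).
exact: newton_powR_continuous.
Qed.

Lemma is_derive_green i x : ~ E x ->
  is_derive x (delta_mx ord0 i) green (green_partial i x).
Proof.
move=> Ex; apply: (near_eq_is_derive (near_green Ex)).
have hN := is_derive_newton d0 dn cE E0 muE C1 Creg i Ex.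
have hp := is_derive1_powR (- alpha^-1) (newton_pos Ex).
apply: (is_derive_eq (is_derive_compl hp hN)).
rewrite /green_partial; field; rewrite gt_eqF//.
Qed.

Lemma green_partial_continuous i x : ~ E x -> {for x, continuous (green_partial i)}.
Proof.
move=> Ex; apply: (@continuous_mul _ _
  (fun x => (n%:R - 2) / alpha * newton E mu x `^ (- alpha^-1 - 1)) (rieszpot E mu i)).
  apply: (@continuous_mul _ _ (fun=> (n%:R - 2) / alpha)).
    exact: continuous_cst.
  exact: newton_powR_continuous.
exact: (rieszpot_continuous d0 dn cE E0 muE C1 Creg).
Qed.

(** A negative power reverses the lower bound [newton_lower]. It is used with [s = 1/alpha] for
    [green] and with [s = 1/alpha + 1] for its gradient. *)
Lemma newton_powR_upper (s : R) : 0 <= s -> exists2 K : R, 0 <= K & forall x, ~ E x ->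
  newton E mu x `^ (- s) <= K * Defs.edist x E `^ (alpha * s).
Proof.
move=> s0; have [c c0 H] := newton_lower d0 dn cE E0 muE C1 Creg.
exists (c `^ (- s)); first exact: powR_ge0.
move=> x Ex; have e0 := edist_gt0 cE E0 Ex.
have p0 : 0 < c * Defs.edist x E `^ (- alpha) by rewrite mulr_gt0// powR_gt0.
have ns0 : - s <= 0 by rewrite oppr_le0.
have := ler_powR_neg p0 (H x Ex) ns0.
rewrite powRM ?powR_ge0 ?(ltW c0)// -powRrM.
by rewrite mulrNN.
Qed.

Lemma green_upper : exists2 K : R, 0 <= K & forall x, ~ E x ->
  green x <= K * Defs.edist x E.
Proof.
have ai : 0 <= alpha^-1 by rewrite invr_ge0 ltW.
have [K K0 H] := newton_powR_upper ai; exists K => // x Ex.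
rewrite green_offE//; apply: le_trans (H x Ex) _.
by rewrite mulfV ?gt_eqF// powRr1// edist_ge0.
Qed.

(** The power of [newton] decays like [dist(x, E)^(n-d-1)], because
    [alpha (1/alpha + 1) = n - d - 1], and this compensates the growth of [rieszpot]. The bound
    holds up to the boundary. *)
Lemma green_partial_bound : exists2 M : R, 0 <= M & forall i x, ~ E x ->
  `|green_partial i x| <= M.
Proof.
have ai : 0 <= alpha^-1 + 1 by rewrite addr_ge0// invr_ge0 ltW.
have [K K0 H] := newton_powR_upper ai.
have [L L0 HL] := rieszpot_upper d0 dn cE E0 muE C1 Creg.
have q0 : 0 <= (n%:R - 2) / alpha by rewrite divr_ge0 ?(ltW a0)// subr_ge0 ltW.
exists ((n%:R - 2) / alpha * (K * L)).
  by rewrite mulr_ge0// mulr_ge0.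
move=> i x Ex; have e0 := edist_gt0 cE E0 Ex.
rewrite /green_partial -mulrA normrM (ger0_norm q0) ler_wpM2l//.
rewrite normrM (ger0_norm (powR_ge0 _ _)).
have -> : - alpha^-1 - 1 = - (alpha^-1 + 1) by ring.
apply: le_trans (ler_pM (powR_ge0 _ _) (normr_ge0 _) (H x Ex) (HL i x Ex)) _.
have -> : alpha * (alpha^-1 + 1) = n%:R - d - 1 by rewrite mulrDr mulfV ?gt_eqF//; ring.
rewrite powRN mulrACA mulfV ?mulr1// gt_eqF//.
exact: powR_gt0.
Qed.

Lemma green_continuous : continuous green.
Proof.
move=> x; have [Ex|/green_continuous_off//] := pselect (E x).
have [K K0 H] := green_upper.
apply/(@cvgrPdist_lt _ R^o _ (nbhs x)) => e e_gt0.
(* [K] may be 0, so the tolerance is divided by [K + 1]. *)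
have K10 : 0 < K + 1 by rewrite ltr_wpDl.
near=> y; rewrite green_onE// sub0r normrN.
have [Ey|Ey] := pselect (E y); first by rewrite green_onE// normr0.
rewrite ger0_norm ?(ltW (green_gt0 Ey))//.
apply: le_lt_trans (H y Ey) _.
have : enorm (y - x) < e / (K + 1) by near: y; apply: near_enorm; rewrite divr_gt0.
rewrite ltr_pdivlMr//; apply: le_lt_trans.
rewrite mulrC; apply: ler_pM => //; first exact: edist_ge0.
  exact: edist_le.
by rewrite lerDl.
Unshelve. all: by end_near. Qed.

Lemma green_weak_gradient :
  weak_gradient (~` E) green (fun x => \row_i green_partial i x).
Proof.
apply: weak_gradient_classical => //.
- by move=> x; exact: green_continuous_off.
- by move=> i x; exact: is_derive_green.
- by move=> i x; exact: green_partial_continuous.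
Qed.

(** The support of [phi] may meet [E]. There the gradient of the product is still bounded, and local
    integrability of the weight bounds the energy. *)
Lemma cutoff_green_W O phi : test_function O phi -> W d E (fun x => phi x * green x).
Proof.
move=> /test_function_C1[K KO Cphi]; split.
  apply: L1loc_continuous => // x Ex.
  case: (Cphi) => _ _ cphi _ _.
  by apply: continuous_mul; [exact: cphi|exact: green_continuous].
case: (Cphi) => cK phi0 cphi phiE cdphi.
have dphi0 := C1_supported_partial0 Cphi.
pose g i x := partial i phi x * green x + phi x * green_partial i x.
have cg i x : ~ E x -> {for x, continuous (g i)}.
  move=> Ex; apply: (@continuous_add _ _ (fun x => partial i phi x * green x)
    (fun x => phi x * green_partial i x)).
    by apply: continuous_mul; [exact: cdphi|exact: green_continuous].
  by apply: continuous_mul; [exact: cphi|exact: green_partial_continuous].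
exists (fun x => \row_i g i x).
  apply: weak_gradient_classical => //.
  - move=> x Ex; apply: continuous_mul; [exact: cphi|exact: green_continuous].
  - by move=> i x Ex; apply: is_derive_mul; exact: is_derive_green.
have [M [r [M0 r0 Kr phiM dphiM]]] := C1_supported_bound Cphi.
have [N N0 gN] := green_partial_bound.
have [L L0 HL] := compact_support_bounded cK (fun x _ => @green_continuous x).
pose B := M * L + M * N.
have B0 : 0 <= B by rewrite addr_ge0// mulr_ge0.
have gB i x : ~ E x -> `|g i x| <= B.
  move=> Ex; have [Kx|Kx] := pselect (K x); last first.
    by rewrite /g phi0// dphi0// !mul0r addr0 normr0.
  rewrite /g; apply: le_trans (ler_normD _ _) _; apply: lerD.
    by rewrite normrM; apply: ler_pM => //; exact: HL.
  rewrite (normrM (phi x)).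
  exact: (ler_pM (normr_ge0 _) (normr_ge0 _) (phiM x) (gN i x Ex)).
have E1 x : dotv (\row_i g i x) (\row_i g i x) = \sum_i g i x * g i x.
  by apply: eq_bigr => i _; rewrite !mxE.
under eq_integral do rewrite E1.
have far x : r <= enorm x -> forall i, g i x = 0.
  by move=> /Kr Kx i; rewrite /g phi0// dphi0// !mul0r addr0.
have mC : measurable (~` E) by exact: measurableC.
have mB : measurable (~` E `&` eball (0 : 'rV[R]_n) r).
  by apply: measurableI => //; exact: measurable_eball.
have mw D : measurable_fun D (fun x => Defs.edist x E `^ (- (n%:R - d - 1))).
  apply: (measurableT_comp (measurable_powR _)).
  by apply: continuous_measurable_rV; exact: edist_continuous.
have mg i : measurable_fun (~` E) (g i).
  by apply: measurable_fun_open_continuous => // x; exact: cg.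
rewrite (_ : (\int[_]_(x in _) _)%E = (\int[@leb R n]_(x in ~` E `&` eball 0%R r)
    ((\sum_i g i x * g i x) * Defs.edist x E `^ (- (n%:R - d - 1)))%:E)%E); last first.
  rewrite integral_mkcondr; apply: eq_integral => x _; rewrite patchE.
  case: ifPn => //; rewrite notin_setE /eball/= subr0 => /negP; rewrite -leNgt.
  by move=> /far fx; rewrite big1 ?mul0r// => i _; rewrite fx mul0r.
apply: (@le_lt_trans _ _ (\int[@leb R n]_(x in ~` E `&` eball 0%R r)
    ((n%:R * B ^+ 2)%:E * (Defs.edist x E `^ (- (n%:R - d - 1)))%:E))%E).
  apply: ge0_le_integral => //.
  - move=> x _; rewrite lee_fin mulr_ge0 ?powR_ge0//.
    by apply: sumr_ge0 => i _; rewrite -expr2 sqr_ge0.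
  - apply/measurable_EFinP; apply: measurable_funM => //.
    apply: measurable_sum => i; apply: (measurable_funS mC); first by move=> x [].
    exact: measurable_funM.
  - apply: emeasurable_funM; first exact: measurable_cst.
    exact/measurable_EFinP.
  - move=> x [Ex xr]; rewrite -EFinM lee_fin ler_wpM2r ?powR_ge0//.
    rewrite mulr_natl -[X in _ *+ X]card_ord -sumr_const; apply: ler_sum => i _.
    rewrite -expr2 -[_ ^+ 2]ger0_norm ?sqr_ge0// normrX.
    by rewrite ler_pXn2r ?nnegrE// gB.
rewrite ge0_integralZl//.
- rewrite lte_mul_pinfty//; first by rewrite lee_fin mulr_ge0// sqr_ge0.
  exact: (weight_integral n2 cE E0 muE C1 Creg r0).
- exact/measurable_EFinP.
- by move=> x _; rewrite lee_fin powR_ge0.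
- by rewrite lee_fin mulr_ge0// sqr_ge0.
Qed.

Let ball_fin := finite_ball_measure cE muE C1 Creg.

Let sm : {sigma_finite_measure set 'rV[R]_n -> \bar R} := finite_on_balls ball_fin.

Lemma C1_supported_mu_integrable K phi dphi : C1_supported K phi dphi ->
  mu.-integrable E (EFin \o phi).
Proof.
move=> Cphi; have [M [r [M0 r0 Kr phiM _]]] := C1_supported_bound Cphi.
case: Cphi => _ phi0 cphi _ _.
have mB := measurable_eball (0 : 'rV[R]_n) r.
have ib : mu.-integrable E (EFin \o (fun y => M * \1_(eball (0 : 'rV[R]_n) r) y)).
  apply: (@integrableZl _ _ _ _ _ mE M (EFin \o _)).
  apply/integrableP; split; first by apply/measurable_EFinP; exact: measurable_indic.
  under eq_integral => y _ do rewrite /= ger0_norm//.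
  rewrite integral_indic//; apply: le_lt_trans (mu_eball_fin cE muE C1 Creg 0 r0).
  by apply: le_measure; rewrite ?inE//; exact: measurableI.
apply: (le_integrableR mE _ ib); first exact: continuous_measurable_rV.
move=> y _; rewrite indicE; have [yr|yr] := ltP (enorm y) r.
  by rewrite mem_set ?mulr1// /eball/= subr0.
by rewrite phi0 ?normr0 ?mulr_ge0//; exact: Kr.
Qed.

Lemma energy_green K phi : C1_supported K phi (fun i => partial i phi) ->
  (energy d E mu alpha (fun x => \row_i green_partial i x) phi =
   - ((((n%:R - 2) / alpha * @riesz_const R n)%:E) * \int[mu]_(x in E) (phi x)%:E))%E.
Proof.
move=> Cphi; have [M [r [M0 r0 Kr phiM dphiM]]] := C1_supported_bound Cphi.
case: (Cphi) => cK phi0 cphi phiE cdphi.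
pose k := (n%:R - 2) / alpha.
pose f (p : 'rV[R]_n * 'rV[R]_n) : R := \sum_i riesz 0 i (p.1 - p.2) * partial i phi p.1.
have mf : measurable_fun setT (EFin \o f).
  apply/measurable_EFinP; apply: measurable_sum => i; apply: measurable_funM.
    exact: measurable_diff_riesz.
  apply: (@measurableT_comp _ _ _ _ _ _ (partial i phi) _ fst) => //.
  by apply: continuous_measurable_rV; exact: cdphi.
have mC : measurable (~` E) by exact: measurableC.
have fi x : ~ E x -> mu.-integrable E (fun y => (f (x, y))%:E).
  move=> Ex.
  rewrite (_ : (fun y => _) = (fun y => \sum_i ((partial i phi x)%:E *
      (EFin \o (fun y => riesz 0 i (x - y))) y))%E).
    apply: integrable_sum => // i _; apply: integrableZl => //.
    exact: (riesz_integrable d0 dn cE E0 muE C1 Creg).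
  apply/funext => y; rewrite /f -sumEFin; apply: eq_bigr => i _.
  by rewrite mulrC EFinM.
have fE x : ~ E x -> (\int[mu]_(y in E) (f (x, y))%:E =
    (\sum_i rieszpot E mu i x * partial i phi x)%:E)%E.
  move=> Ex.
  transitivity (\int[mu]_(y in E) (\sum_i ((partial i phi x)%:E *
      (EFin \o (fun y => riesz 0 i (x - y))) y))%E)%E.
    apply: eq_integral => y _; rewrite /f -sumEFin; apply: eq_bigr => i _.
    by rewrite mulrC EFinM.
  have ri i := riesz_integrable d0 dn cE E0 muE C1 Creg i Ex.
  rewrite integral_sum//; last by move=> i; exact: integrableZl.
  rewrite -sumEFin; apply: eq_bigr => i _.
  rewrite (integralZl mE (ri i)) /rieszpot /Rintegral EFinM fineK 1?muleC//.
  by apply: integrable_fin_num => //; exact: ri.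
(* Pointwise cancellation of the powers of [newton] between the weight and the gradient. *)
have pw x : ~ E x -> (Dmu d E mu alpha x `^ (- (n%:R - d - 1)) *
    dotv (\row_i green_partial i x) (grad phi x))%:E =
    (k%:E * \int[mu]_(y in E) (f (x, y))%:E)%E.
  move=> Ex; rewrite fE// -EFinM; congr EFin.
  have N0 := newton_pos Ex.
  rewrite DmuE -powRrM /dotv !mulr_sumr; apply: eq_bigr => i _.
  rewrite !mxE /green_partial -/k.
  have -> : - alpha^-1 * - (n%:R - d - 1) = - (- alpha^-1 - 1) by field; rewrite gt_eqF.
  rewrite powRN; set w := newton E mu x `^ _.
  have w0 : w != 0 by rewrite gt_eqF// powR_gt0.
  by field.
(* Absolute convergence: the inner integral is at most a constant times [dist(x, E)^-(n-d-1)], and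
   [phi] restricts [x] to a ball, where [weight_integral] applies. *)
have bound : (\int[@leb R n]_(x in ~` E) \int[mu]_(y in E) `|(f (x, y))%:E| < +oo)%E.
  have [K' K0 H] := rieszpot_abs_upper d0 dn cE E0 muE C1 Creg.
  have mw D : measurable_fun D (fun x => Defs.edist x E `^ (- (n%:R - d - 1))).
    apply: (measurableT_comp (measurable_powR _)).
    by apply: continuous_measurable_rV; exact: edist_continuous.
  have mB : measurable (~` E `&` eball (0 : 'rV[R]_n) r).
    by apply: measurableI => //; exact: measurable_eball.
  have far x y : r <= enorm x -> f (x, y) = 0.
    move=> /Kr Kx; rewrite /f big1// => i _.
    by rewrite (C1_supported_partial0 Cphi)// mulr0.
  rewrite (_ : (\int[_]_(x in _) _)%E = (\int[@leb R n]_(x in ~` E `&` eball 0%R r)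
     \int[mu]_(y in E) `|(f (x, y))%:E|)%E); last first.
    rewrite integral_mkcondr; apply: eq_integral => x _; rewrite patchE.
    case: ifPn => //; rewrite notin_setE /eball/= subr0 => /negP; rewrite -leNgt => xr.
    by rewrite integral0_eq// => y _; rewrite far//= normr0.
  apply: (@le_lt_trans _ _ (\int[@leb R n]_(x in ~` E `&` eball 0%R r)
      ((n%:R * (M * K'))%:E * (Defs.edist x E `^ (- (n%:R - d - 1)))%:E))%E).
    apply: ge0_le_integral => //.
    - by move=> x _; exact: integral_ge0.
    - apply: measurable_funTS.
      apply: (@measurable_iterated1 _ _ _ _ _ _ mE sm (fun p => `|(f p)%:E|)%E) => //.
      exact: measurableT_comp.
    - apply: emeasurable_funM; first exact: measurable_cst.
      exact/measurable_EFinP.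
    - move=> x [Ex xr].
      apply: (@le_trans _ _ (\int[mu]_(y in E)
          \sum_i (M%:E * `|(riesz 0 i (x - y))%:E|))%E).
        apply: ge0_le_integral => //.
        + apply: measurableT_comp => //; exact: (measurable_int _ (fi x Ex)).
        + apply: emeasurable_sum => i; apply: emeasurable_funM => //.
          apply: measurableT_comp => //; apply/measurable_EFinP.
          exact: measurable_riesz_sub.
        + move=> y _; under eq_bigr do rewrite -EFinM; rewrite sumEFin lee_fin.
          apply: le_trans (ler_norm_sum _ _ _) _; apply: ler_sum => i _.
          by rewrite normrM mulrC ler_wpM2r.
      have mr i : measurable_fun E (fun y => `|(riesz 0 i (x - y))%:E|)%E.
        apply: measurableT_comp => //; apply/measurable_EFinP.
        exact: measurable_riesz_sub.
      rewrite ge0_integral_sum//; last 2 first.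
      - by move=> i; apply: emeasurable_funM.
      - by move=> i y _; rewrite mule_ge0.
      apply: (@le_trans _ _ (\sum_(i < n)
          (M * K' * Defs.edist x E `^ (- (n%:R - d - 1)))%:E)%E).
        apply: lee_sum => i _; rewrite ge0_integralZl_EFin//.
        by rewrite -mulrA EFinM; apply: lee_wpmul2l => //; exact: H.
      rewrite sumEFin sumr_const card_ord -EFinM lee_fin -[leLHS]mulr_natl.
      by rewrite !mulrA.
  rewrite ge0_integralZl//.
  - rewrite lte_mul_pinfty//; first by rewrite lee_fin !mulr_ge0.
    exact: (weight_integral n2 cE E0 muE C1 Creg r0).
  - exact/measurable_EFinP.
  - by move=> x _; rewrite lee_fin powR_ge0.
  - by rewrite lee_fin !mulr_ge0.
have swap := @fubini_on _ _ _ _ _ _ _ mC mE (@leb R n) sm (EFin \o f) mf bound.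
(* The pole [y] lies in [E], inside the removed set; since [E] is Lebesgue null, the integral equals
   the one over the whole space. *)
have inner y : (\int[@leb R n]_(x in ~` E) (f (x, y))%:E =
    (- (@riesz_const R n * phi y))%:E)%E.
  rewrite -(kernel_distribution n2 y Cphi).
  rewrite (negligible_integral mE measurableT (integrable_kernel_pairing n2 y Cphi)
    (leb_boundary dn1 cE muE C1 Creg)).
  by rewrite setTD.
have iphi := C1_supported_mu_integrable Cphi.
have rhs : (\int[@leb R n]_(x in ~` E) \int[mu]_(y in E) (f (x, y))%:E =
    - ((@riesz_const R n)%:E * \int[mu]_(y in E) (phi y)%:E))%E.
  rewrite [LHS]swap; under eq_integral => y _ do rewrite inner -mulNr EFinM.
  by rewrite (integralZl mE iphi) EFinN mulNe.
rewrite /energy.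
have -> : (\int[@leb R n]_(x in ~` E) (Dmu d E mu alpha x `^ (- (n%:R - d - 1)) *
      dotv (\row_i green_partial i x) (grad phi x))%:E =
    \int[@leb R n]_(x in ~` E) (k%:E * \int[mu]_(y in E) (f (x, y))%:E))%E.
  by apply: eq_integral => x; rewrite inE => Ex; exact: pw.
have ipair : (@leb R n).-integrable (~` E) (fun x => \int[mu]_(y in E) (f (x, y))%:E)%E.
  have mI : measurable_fun (~` E) (fun x => \int[mu]_(y in E) (f (x, y))%:E)%E.
    apply: (@eq_measurable_fun _ _ _ _ _
      (fun x => (\sum_i rieszpot E mu i x * partial i phi x)%:E)).
      by move=> x; rewrite inE => Ex; rewrite fE.
    apply/measurable_EFinP; apply: measurable_sum => i; apply: measurable_funM.
      apply: measurable_fun_open_continuous => // x Ex.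
      exact: (rieszpot_continuous d0 dn cE E0 muE C1 Creg).
    exact: continuous_measurable_rV.
  apply/integrableP; split => //.
  apply: le_lt_trans bound; apply: ge0_le_integral => //.
  - exact: measurableT_comp.
  - apply: measurable_funTS.
    apply: (@measurable_iterated1 _ _ _ _ _ _ mE sm (fun p => `|(f p)%:E|)%E) => //.
    exact: measurableT_comp.
  - by move=> x Ex; apply: le_abse_integral => //; exact: (measurable_int _ (fi x Ex)).
rewrite integralZl// rhs muleN muleA -EFinM.
by [].
Qed.

End green_function.

Theorem corollary6p6 (R : realType) (n : nat) (d : R) (E : set 'rV[R]_n)
    (mu : {measure set 'rV[R]_n -> \bar R}) :
  0 < d -> d < n%:R - 2 ->
  ~ bounded_set E ->
  ahlfors_regular_set d E ->
  ahlfors_regular_measure d E mu ->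
  let alpha := n%:R - d - 2 in
  green_function_at_infinity d E mu alpha
    (fun x => if x \in E then 0 else Dmu d E mu alpha x).
Proof.
move=> d0 dn nE _ Amu alpha.
have [C C1 Creg] := ahlfors_regular_with nE Amu.
have E0 := unbounded_nonempty nE.
have [cE _ muE _] := Amu.
have mE : measurable E by exact: closed_measurable_rV.
have n2 : (2 : R) < n%:R by rewrite -subr_gt0 (lt_trans d0).
have a0 : 0 < alpha by rewrite /alpha; lra.
have k0 : 0 <= (n%:R - 2) / alpha * @riesz_const R n.
  apply: mulr_ge0; last exact: riesz_const_ge0.
  by rewrite divr_ge0 ?(ltW a0)// subr_ge0 ltW.
(* The constant joins [(n - 2) / alpha] from the chain rule with the mass of the fundamental
   solution. *)
pose omega : {measure set 'rV[R]_n -> \bar R} := mscale (NngNum k0) mu.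
have grad_u := green_weak_gradient d0 dn cE E0 muE C1 Creg.
have energyE phi : test_function setT phi ->
    (energy d E mu alpha (fun x => \row_i green_partial d E mu i x) phi =
     - \int[omega]_(x in E) (phi x)%:E)%E.
  move=> /test_function_C1[K _ Cphi].
  rewrite (energy_green d0 dn cE E0 muE C1 Creg Cphi) integral_mscale//.
  exact: (C1_supported_mu_integrable cE muE C1 Creg Cphi).
rewrite -[X in green_function_at_infinity _ _ _ _ X]/(green d E mu).
exists omega; split.
- split; last exact: (green_continuous d0 dn cE E0 muE C1 Creg).
  move=> Q r _ _; split => [|phi tphi].
    apply: L1loc_continuous => [|x _]; first exact: eball_open.
    exact: (green_continuous d0 dn cE E0 muE C1 Creg).
  exact: (cutoff_green_W d0 dn cE E0 muE C1 Creg tphi).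
- split => x Ex; last exact: green_onE.
  exact: (green_gt0 d0 dn cE E0 muE C1 Creg).
(* A special case of [energyE]: a test function supported off [E] has integral 0 over [E]. *)
- exists (fun x => \row_i green_partial d E mu i x) => // phi tphi.
  have tphi' : test_function setT phi.
    by case: tphi => sphi [K [cK _ phi0]]; split => //; exists K.
  rewrite energyE// integral0_eq ?oppe0// => x Ex; congr EFin.
  by case: tphi => _ [K [_ KE phi0]]; apply: phi0 => /KE.
- split => [x|]; last by rewrite /omega /= /mscale muE mule0.
  exists (eball x 1); split; first exact: eball_open.
    by rewrite /eball/= subrr enorm0.
  rewrite /omega /= /mscale lte_mul_pinfty//.
  exact: (mu_eball_fin cE muE C1 Creg x ltr01).
- by exists (fun x => \row_i green_partial d E mu i x).
Qed.
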